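(* Let $f\in L^2(\Omega)$ and, for each $n\ge1$, let $u_n\in W_{Dir}$ be the solution of the Dirichlet problem $$ \begin{aligned} f(x) ={}& \chi_{A_n}(x)\int_{A_n} J(x,y)(u_n(y)-u_n(x))\,dy + \chi_{A_n}(x)\int_{B_n} R(x,y)(u_n(y)-u_n(x))\,dy\\ &+\chi_{B_n}(x)\int_{A_n} R(x,y)(u_n(y)-u_n(x))\,dy+\chi_{B_n}(x)\int_{B_n} G(x,y)(u_n(y)-u_n(x))\,dy,\qquad x\in\Omega, \end{aligned} $$ with $u_n\equiv0$ outside $\Omega$. Assume $\chi_{A_n}\to X$ weakly-* in $L^\infty(\mathbb{R}^N)$ and that there exist constants $c_0>0$ and $c_1>0$ such that $$1-c_1\ge X(x)\ge c_0>0\qquad\text{for all }x\in\Omega .$$ Let $u_A,u_B$ be the weak limits in $L^2(\Omega)$ of $\chi_{A_n}u_n$ and $\chi_{B_n}u_n$, and set, for $x\in\Omega$, $$\psi_n(x)=\frac{\chi_{A_n}(x)u_A(x)}{X(x)}+\frac{\chi_{B_n}(x)u_B(x)}{1-X(x)} .$$ Then $$\|u_n-\psi_n\|_{L^2(\Omega)}\to0\qquad\text{as }n\to+\infty .$$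
   Context: $\Omega\subset\mathbb{R}^N$ is a bounded domain (open, connected). The kernels $V=J,G,R$ each satisfy: $V:\mathbb{R}^N\times\mathbb{R}^N\to\mathbb{R}$ is continuous and non-negative, $V(x,x)>0$ for every $x$, $V(x,y)=V(y,x)$ for all $x,y$, and $\int_{\mathbb{R}^N}V(x,y)\,dy=1$ for every $x$. For each $n\ge1$, $A_n,B_n$ are measurable sets with $\mathbb{R}^N=A_n\cup B_n$ and $A_n\cap B_n=\emptyset$; $\chi_E$ denotes the characteristic function of $E$. $W_{Dir}=\{u\in L^2(\mathbb{R}^N): u=0\text{ in }\mathbb{R}^N\setminus\Omega\}$. Equations are understood for a.e. $x\in\Omega$. Under the weak-* convergence, the weak limits $u_A,u_B$ exist and, extended by zero outside $\Omega$, form the unique pair solving, for $x\in\Omega$, $$X(x)f(x)=\int_{\mathbb{R}^N}J(x,y)[X(x)u_A(y)-X(y)u_A(x)]dy+\int_{\mathbb{R}^N}R(x,y)[X(x)u_B(y)-u_A(x)(1-X(y))]dy,$$ $$(1-X(x))f(x)=\int_{\mathbb{R}^N}R(x,y)[u_A(y)(1-X(x))-u_B(x)X(y)]dy+\int_{\mathbb{R}^N}G(x,y)[u_B(y)(1-X(x))-u_B(x)(1-X(y))]dy.$$ *)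

(* Defs.v *)
From HB Require Import structures.
From mathcomp Require Import all_boot all_order all_algebra.
From mathcomp Require Import all_classical all_reals all_analysis.

Set Implicit Arguments.
Unset Strict Implicit.
Unset Printing Implicit Defensive.

Import Order.TTheory GRing.Theory Num.Theory.
Import numFieldNormedType.Exports.

Local Open Scope classical_set_scope.
Local Open Scope ring_scope.

(* MathComp-Analysis has Lebesgue measure on the line only.  Lebesgue measure
   on R^N is built here in the textbook way: the outer measure of X is the
   infimum of the total volumes of countable covers of X by closed boxes, and
   the measurable sets are the Caratheodory-measurable ones, i.e. all Lebesgue
   measurable sets and not only the Borel ones.
   R^N is the type 'rV[R]_N of row vectors; all dimensions are written N.+1,
   since the construction requires a positive dimension. *)

Section LebesgueOuter.
Variables (R : realType) (N : nat).
Implicit Types (X : set 'rV[R]_N.+1) (c : ('rV[R]_N.+1 * 'rV[R]_N.+1)^nat).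

Definition box (ab : 'rV[R]_N.+1 * 'rV[R]_N.+1) : set 'rV[R]_N.+1 :=
  [set x | forall i, ab.1 ord0 i <= x ord0 i <= ab.2 ord0 i].

Definition box_volume (ab : 'rV[R]_N.+1 * 'rV[R]_N.+1) : \bar R :=
  (\prod_i (ab.2 ord0 i - ab.1 ord0 i))%:E.

Definition box_cover X : set (('rV[R]_N.+1 * 'rV[R]_N.+1)^nat) :=
  [set c : nat -> 'rV[R]_N.+1 * 'rV[R]_N.+1 |
           (forall k i, (c k).1 ord0 i <= (c k).2 ord0 i) /\
           X `<=` \bigcup_k box (c k)].

Definition lebesgue_outer X : \bar R :=
  ereal_inf [set (\sum_(k <oo) box_volume (c k))%E
            | c in box_cover X].

Let volume_ge0 X c k : box_cover X c ->
  (0 <= box_volume (c k))%E.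
Proof.
move=> [cle _]; rewrite lee_fin; apply: prodr_ge0 => i _.
by rewrite subr_ge0.
Qed.

Let lebesgue_outer_ge0 X : (0 <= lebesgue_outer X)%E.
Proof.
apply: le_ereal_inf_tmp => _ [c cX <-].
by apply: nneseries_ge0 => k _ _; exact: (volume_ge0 _ cX).
Qed.

Let lebesgue_outer0 : lebesgue_outer set0 = 0%E.
Proof.
apply/eqP; rewrite eq_le lebesgue_outer_ge0 andbT.
apply: ereal_inf_lbound; exists (fun=> (0, 0)).
  by split => [k i|x []]; rewrite /= lexx.
rewrite eseries0// => k _ _.
by rewrite /box_volume big_ord_recl subrr mul0r.
Qed.

Let le_lebesgue_outer : {homo lebesgue_outer : X Y / X `<=` Y >-> (X <= Y)%E}.
Proof.
move=> X Y XY; apply/ereal_inf_le_tmp => _ [c [cle cY] <-].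
by exists c => //; split => //; exact: subset_trans cY.
Qed.

Let lebesgue_outer_sigma_subadditive : sigma_subadditive lebesgue_outer.
Proof.
move=> F; have [[i ioo]|] := pselect (exists i, lebesgue_outer (F i) = +oo%E).
  rewrite (eseries_pinfty _ _ ioo) ?leey// => n _.
  by rewrite -ltNye (lt_le_trans _ (lebesgue_outer_ge0 _)).
rewrite -forallNE => Foo; apply/lee_addgt0Pr => e e0.
rewrite (le_trans _ (epsilon_trick _ _ (ltW e0)))//.
have [c cP] : {c : nat -> ('rV[R]_N.+1 * 'rV[R]_N.+1)^nat & forall n,
    box_cover (F n) (c n) /\
    (\sum_(k <oo) box_volume (c n k) <=
      lebesgue_outer (F n) + (e / (2 ^ n.+1)%:R)%:E)%E}.
  apply: (@choice _ _ (fun n d => box_cover (F n) d /\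
    (\sum_(k <oo) box_volume (d k) <=
      lebesgue_outer (F n) + (e / (2 ^ n.+1)%:R)%:E)%E)) => n.
  have en : 0 < e / (2 ^ n.+1)%:R by rewrite divr_gt0// ltr0n expn_gt0.
  have fn : lebesgue_outer (F n) \is a fin_num.
    by rewrite ge0_fin_numE// ltey; apply/eqP; exact: Foo.
  have [_ [d dF <-] dlt] := lb_ereal_inf_adherent en fn.
  by exists d; split => //; exact/ltW.
pose v (p : nat * nat) := box_volume (c p.1 p.2).
have v0 p : (0 <= v p)%E by exact: (volume_ge0 _ (cP p.1).1).
have [f bf] : exists f : nat -> nat * nat, set_bij setT setT f.
  by have /card_esym/pcard_eqP/bijPex[f ?] := card_nat2; exists f.
apply: (@le_trans _ _ (\esum_(i in setT) v i)%E).
  apply: ereal_inf_lbound; exists (fun k => c (f k).1 (f k).2).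
    split => [k i|x [n _ Fx]]; first exact: (cP (f k).1).1.1.
    have [k _ cx] := (cP n).1.2 _ Fx.
    have [_ _ /(_ (n, k) I)[j _ fj]] := bf.
    by exists j => //; rewrite fj.
  rewrite nneseries_esumT; last by move=> k; exact: v0.
  by rewrite (reindex_esum setT setT f).
rewrite (_ : [set: nat * nat] = setT `*`` (fun=> setT)); last first.
  by apply/seteqP; split.
rewrite -(@esum_esum _ _ _ _ _ (fun i j => v (i, j)))//.
rewrite nneseries_esumT//; last first.
  by move=> n; rewrite adde_ge0// lee_fin divr_ge0// ltW.
apply: le_esum => n _; rewrite -nneseries_esumT//; exact: (cP n).2.
Qed.

HB.instance Definition _ := isOuterMeasure.Build R 'rV[R]_N.+1 lebesgue_outer
  lebesgue_outer0 lebesgue_outer_ge0 le_lebesgue_outer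
  lebesgue_outer_sigma_subadditive.

End LebesgueOuter.

(* R^N with the sigma-algebra of Lebesgue measurable sets *)
Notation Rn R N := (caratheodory_type (@lebesgue_outer R N)).

(* The library's measure on Caratheodory sets is only found by unification for
   an abstract outer measure, hence this packaging step. *)
Definition caratheodory_measure (R : realType) (T : pointedType)
    (mu : {outer_measure set T -> \bar R}) :
  {measure set (caratheodory_type mu) -> \bar R} :=
  [the measure _ _ of (mu : set (caratheodory_type mu) -> \bar R)].

Definition leb (R : realType) (N : nat) : {measure set (Rn R N) -> \bar R} :=
  caratheodory_measure (@lebesgue_outer R N).
Arguments leb : clear implicits.

Section NonlocalDirichlet.
Variables (R : realType) (N : nat).
Implicit Types (V J G K : 'rV[R]_N.+1 -> 'rV[R]_N.+1 -> R).
Implicit Types (Omega A B : set (Rn R N)) (f g h u X : Rn R N -> R).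

Definition bounded_domain (Omega : set 'rV[R]_N.+1) : Prop :=
  [/\ open Omega, connected Omega & bounded_set Omega].

Record admissible_kernel V : Prop := AdmissibleKernel {
  kernel_continuous : continuous (fun p => V p.1 p.2);
  kernel_ge0 : forall x y, 0 <= V x y;
  kernel_diag_gt0 : forall x, 0 < V x x;
  kernel_sym : forall x y, V x y = V y x;
  kernel_integral1 : forall x, (\int[leb R N]_y (V x y)%:E = 1)%E }.

(* A function on Omega is represented by any function on R^N, of which only
   the values on Omega matter: g \_ Omega is g on Omega and 0 elsewhere. *)
Definition L2 Omega g : Prop := (g \_ Omega) \in Lfun (leb R N) 2%:E.

Definition L2norm Omega g : \bar R :=
  ('N[leb R N]_2%:E [EFin \o (g \_ Omega)])%E.

Definition weak_L2_cvg Omega (g : nat -> Rn R N -> R) h : Prop :=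
  [/\ forall n, L2 Omega (g n), L2 Omega h &
    forall phi, L2 Omega phi ->
      (\int[leb R N]_(x in Omega) (g n x * phi x)) @[n --> \oo] -->
      \int[leb R N]_(x in Omega) (h x * phi x)].

Definition weakstar_Linfty_cvg (g : nat -> Rn R N -> R) h : Prop :=
  [/\ forall n, g n \in Lfun (leb R N) +oo%E, h \in Lfun (leb R N) +oo%E &
    forall phi, phi \in Lfun (leb R N) 1%E ->
      (\int[leb R N]_x (g n x * phi x)) @[n --> \oo] -->
      \int[leb R N]_x (h x * phi x)].

Definition W_Dir Omega : set (Rn R N -> R) :=
  [set u | u \in Lfun (leb R N) 2%:E /\
           {ae leb R N, forall x, ~ Omega x -> u x = 0}].

Definition nonlocal_int V (E : set (Rn R N)) u (x : Rn R N) : R :=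
  \int[leb R N]_(y in E) (V x y * (u y - u x)).

(* K is the kernel that couples A and B (often written R, which here is the
   field of real numbers). *)
Definition dirichlet_solution Omega J G K A B f u : Prop :=
  W_Dir Omega u /\
  {ae leb R N, forall x, Omega x ->
    f x = \1_A x * nonlocal_int J A u x + \1_A x * nonlocal_int K B u x
        + \1_B x * nonlocal_int K A u x + \1_B x * nonlocal_int G B u x}.

Definition corrector A B uA uB X : Rn R N -> R :=
  fun x => \1_A x * uA x / X x + \1_B x * uB x / (1 - X x).

End NonlocalDirichlet.

(* Main.v *)
Require Import Defs.
From HB Require Import structures.
From mathcomp Require Import all_boot all_order all_algebra.
From mathcomp Require Import all_classical all_reals all_analysis.
From mathcomp Require Import measurable_realfun lra ring.

Set Implicit Arguments.
Unset Strict Implicit.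
Unset Printing Implicit Defensive.

Import Order.TTheory GRing.Theory Num.Theory.
Import numFieldNormedType.Exports.

(** On each phase the equation is algebraic in [u n x]. At a point [x] of [A n] it
    reads [f x = F n x - a n x * u n x], where the mass [a n x] is the integral of
    [J x] over [A n] plus that of [K x] over [B n], and the flux [F n x] is the
    integral of [J x] against [1_A u] plus that of [K x] against [1_B u]. The
    oscillation of [A n] enters these two coefficients only through integrals
    against fixed functions, so the weak convergences turn into pointwise ones:
    [a n x] tends to a limit [a x] ([phase_mass_cvg]), and [F n x] to a limit [F x]
    ([phase_flux_cvg]). Hence [u n = (F n - f) / a n] on [A n], and the quotient
    tends pointwise to [z = (F - f) / a]: all the oscillation of [u n] is in the
    choice between two strongly convergent sequences, one for each phase.

    To pass from pointwise to L2 convergence, two bounds uniform in [n] are used.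
    - The masses are bounded below ([kernels_mass_ge]): both kernels are positive
      near the diagonal, uniformly by compactness, and [A n] and [B n] together
      fill a ball around [x].
    - The fluxes are bounded above: they are linear in the L1 norm of [u n], which
      is bounded. Indeed [|u n|] is at most a multiple of the fluxes plus [|f|],
      and the fluxes converge pointwise; divided by one plus the L1 norm, their
      distances to the limit are bounded, so dominated convergence makes their
      integrals small ([implicit_L1_bound]).

    Then [1_A (u n - z)] tends to 0 in L2. Testing against an arbitrary function,
    [1_A u n] has the same weak limit as [1_A z], namely [X z]; so [uA = X z], and
    [z = uA / X] is the corrector on [A n] ([one_phase_strong_cvg]). The phase [B]
    is treated alike with the kernels [K] and [G] and the weak limit [1 - X].

    The measure-theoretic groundwork concerns Lebesgue measure on row vectors:
    half-spaces are Caratheodory measurable ([measurable_halfspace]), whence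
    continuous kernels are jointly measurable and the coefficients are measurable
    functions of [x] by Tonelli's theorem ([measurable_kernel_integral]); balls
    have positive measure ([leb_ball_gt0]). *)

Local Open Scope classical_set_scope.
Local Open Scope ring_scope.

(** * Square-integrable functions and dominated convergence *)

Lemma measurable_fun_divr d (T : measurableType d) (R : realType) (D : set T)
    (f g : T -> R) : measurable D ->
  measurable_fun D f -> measurable_fun D g -> (forall x, D x -> 0 < g x) ->
  measurable_fun D (fun x => f x / g x).
Proof.
move=> mD mf mg g0; apply: measurable_funM => //.
(* on positive reals the inverse is a real power *)
apply: (eq_measurable_fun (fun x => g x `^ (-1))).
  by move=> x /[!inE] Dx; rewrite powR_inv1// ltW// g0.
by apply: (@measurableT_comp _ _ _ _ _ _ (@powR R ^~ (-1))) => //;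
  exact: measurable_powR.
Qed.

Lemma measurable_fun_normr d (T : measurableType d) (R : realType) (D : set T)
    (f : T -> R) : measurable_fun D f -> measurable_fun D (fun x => `|f x|).
Proof. by move=> mf; exact: measurableT_comp. Qed.

Section SquareIntegrable.
Context d (T : measurableType d) (R : realType).
Variables (mu : {measure set T -> \bar R}) (D : set T).
Hypothesis mD : measurable D.
Implicit Types f g h : T -> R.

Definition sq_integrable f : Prop :=
  measurable_fun D f /\ mu.-integrable D (fun x => (f x ^+ 2)%:E).

Lemma integrable_dom f g : measurable_fun D f -> mu.-integrable D (EFin \o g) ->
  (forall x, D x -> `|f x| <= g x) -> mu.-integrable D (EFin \o f).
Proof.
move=> mf ig fg; apply: (le_integrable mD _ _ ig); first exact/measurable_EFinP.
by move=> x Dx /=; rewrite lee_fin (le_trans (fg _ Dx))// ler_norm.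
Qed.

Lemma sq_integrableD f g : sq_integrable f -> sq_integrable g ->
  sq_integrable (f \+ g).
Proof.
move=> [mf if2] [mg ig2]; split; first exact: measurable_funD.
have i2 : mu.-integrable D (EFin \o (fun x => 2 * f x ^+ 2 + 2 * g x ^+ 2)).
  by apply: (integrableD mD (integrableZl mD 2 if2) (integrableZl mD 2 ig2)).
apply: integrable_dom i2 _.
  exact/measurable_funX/measurable_funD.
move=> x _ /=; rewrite ger0_norm ?sqr_ge0//.
have := sqr_ge0 (f x - g x); nra.
Qed.

Lemma sq_integrable_dom f g : measurable_fun D f -> sq_integrable g ->
  (forall x, D x -> `|f x| <= `|g x|) -> sq_integrable f.
Proof.
move=> mf [mg ig2] fg; split => //; apply: (integrable_dom _ ig2).
  exact/measurable_funX.
by move=> x Dx; rewrite ger0_norm ?sqr_ge0// -[leLHS]real_normK ?num_real//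
  -[leRHS]real_normK ?num_real// lerXn2r ?nnegrE// fg.
Qed.

Lemma sq_integrableZ (k : R) f : sq_integrable f ->
  sq_integrable (fun x => k * f x).
Proof.
move=> [mf if2]; split; first exact: measurable_funM.
rewrite (_ : (fun x => _) = (fun x => (k ^+ 2)%:E * (f x ^+ 2)%:E)%E).
  exact: integrableZl.
by apply/funext => x; rewrite exprMn EFinM.
Qed.

Lemma sq_integrable_mul f g : sq_integrable f -> sq_integrable g ->
  mu.-integrable D (EFin \o (f \* g)).
Proof.
move=> [mf if2] [mg ig2].
have i2 : mu.-integrable D (EFin \o (fun x => f x ^+ 2 + g x ^+ 2)).
  exact: (integrableD mD if2 ig2).
apply: integrable_dom i2 _; first exact: measurable_funM.
move=> x _ /=; rewrite normrM.
have := sqr_ge0 (`|f x| - `|g x|).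
rewrite -[f x ^+ 2]real_normK ?num_real// -[g x ^+ 2]real_normK ?num_real//.
have : 0 <= `|f x| * `|g x| by rewrite mulr_ge0.
nra.
Qed.

Hypothesis D_fin : (mu D < +oo)%E.

Lemma integrable_cst_fin (k : R) : mu.-integrable D (EFin \o cst k).
Proof.
apply/integrableP; split; first exact/measurable_EFinP.
by rewrite /= (integral_cst mu mD `|k%:E|%E) lte_mul_pinfty.
Qed.

Lemma sq_integrable_cst (k : R) : sq_integrable (cst k).
Proof. by split => //; exact: (integrable_cst_fin (k ^+ 2)). Qed.

Lemma sq_integrable_integrable f : sq_integrable f ->
  mu.-integrable D (EFin \o f).
Proof.
move=> /sq_integrable_mul /(_ (sq_integrable_cst 1)).
by apply: eq_integrable => // x _ /=; rewrite mulr1.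
Qed.

End SquareIntegrable.

Lemma Rintegral_indic d (T : measurableType d) (R : realType)
    (mu : {measure set T -> \bar R}) (E : set T) (g : T -> R) :
  \int[mu]_(y in E) g y = \int[mu]_y (g y * \1_E y).
Proof.
rewrite Rintegral_mkcond; apply: eq_Rintegral => y _.
by rewrite patchE indicE; case: ifPn; rewrite ?mulr1 ?mulr0.
Qed.

Section DominatedConvergence.
Context d (T : measurableType d) (R : realType).
Variables (mu : {measure set T -> \bar R}) (D : set T).
Hypothesis mD : measurable D.

(** The extended-real form is the one that yields norms, the real form the one
    that yields duality pairings. *)
Lemma dominated_cvgR (f_ : (T -> R)^nat) (f g : T -> R) :
  (forall n, measurable_fun D (f_ n)) ->
  (forall x, D x -> f_ n x @[n --> \oo] --> f x) ->
  mu.-integrable D (EFin \o g) ->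
  (forall n x, D x -> `|f_ n x| <= g x) ->
  ((\int[mu]_(x in D) (f_ n x)%:E) @[n --> \oo] --> \int[mu]_(x in D) (f x)%:E)%E
  /\ \int[mu]_(x in D) (f_ n x) @[n --> \oo] --> \int[mu]_(x in D) (f x).
Proof.
move=> mf_ ff ig fg.
have mf : measurable_fun D f by exact: measurable_fun_cvg ff.
have [ff' _ cv] : [/\ mu.-integrable D (EFin \o f),
  [sequence \int[mu]_(x in D) `|(f_ n x)%:E - (f x)%:E|]_n @ \oo --> 0 &
  [sequence \int[mu]_(x in D) (f_ n x)%:E]_n @ \oo --> \int[mu]_(x in D) (f x)%:E ]%E.
  apply: (@dominated_convergence _ _ _ mu D mD (fun n => EFin \o f_ n)
    (EFin \o f) (EFin \o g)) => //.
  - by move=> n; exact/measurable_EFinP.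
  - exact/measurable_EFinP.
  - by apply: aeW => x Dx; apply: cvg_EFin; [near=> n|exact: ff].
  - by apply: aeW => x n Dx; rewrite lee_fin fg.
split => //; apply: fine_cvg; rewrite fineK//.
exact: integrable_fin_num.
Unshelve. all: by end_near. Qed.

End DominatedConvergence.

(** * Strong convergence on one phase *)

Lemma measurable_phase_error d (T : measurableType d) (R : realType)
    (D A : set T) (u v X : T -> R) :
  measurable D -> measurable A -> measurable_fun D u -> measurable_fun D v ->
  measurable_fun D X -> (forall x, D x -> 0 < X x) ->
  measurable_fun D (fun x => ((\1_A x * (u x - v x / X x)) ^+ 2)%:E).
Proof.
move=> mD mA mu mv mX X0; apply/measurable_EFinP/measurable_funX/measurable_funM.
  by apply: measurable_funTS; exact: measurable_indic.
by apply: measurable_funB => //; exact: measurable_fun_divr.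
Qed.

(** The kernels matter here only through the coefficients [a n] and [F n] of a
    pointwise linear equation for [u n] on [A n], so the argument takes place on
    an arbitrary finite measure space. *)
Section OnePhase.
Context d (T : measurableType d) (R : realType).
Variables (mu : {measure set T -> \bar R}) (D : set T).
Hypothesis mD : measurable D.
Hypothesis D_fin : (mu D < +oo)%E.

Variables (A : (set T)^nat) (u a F : (T -> R)^nat) (f X uA a' F' : T -> R).
Variables (c alpha M : R).
Hypothesis mA : forall n, measurable (A n).
Hypothesis mu_ : forall n, measurable_fun D (u n).
Hypothesis ma : forall n, measurable_fun D (a n).
Hypothesis mF : forall n, measurable_fun D (F n).
Hypothesis f2 : sq_integrable mu D f.
Hypothesis uA2 : sq_integrable mu D uA.
Hypothesis mX : measurable_fun D X.
Hypothesis c0 : 0 < c.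
Hypothesis alpha0 : 0 < alpha.
Hypothesis X_bd : forall x, D x -> c <= X x <= 1.
Hypothesis a_ge : forall n x, D x -> alpha <= a n x.
Hypothesis F_le : forall n x, D x -> `|F n x| <= M.
Hypothesis a_cvg : forall x, D x -> a n x @[n --> \oo] --> a' x.
Hypothesis F_cvg : forall x, D x -> F n x @[n --> \oo] --> F' x.
Hypothesis u_eq : forall n,
  {ae mu, forall x, D x -> A n x -> a n x * u n x = F n x - f x}.
Hypothesis A_weak : forall phi, mu.-integrable D (EFin \o phi) ->
  (\int[mu]_(x in D) (\1_(A n) x * phi x)) @[n --> \oo] -->
  \int[mu]_(x in D) (X x * phi x).
Hypothesis uA_weak : forall phi, sq_integrable mu D phi ->
  (\int[mu]_(x in D) (\1_(A n) x * u n x * phi x)) @[n --> \oo] -->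
  \int[mu]_(x in D) (uA x * phi x).

(* almost everywhere on [A n], [u n] is [z_ n]; [h] dominates all the [z_ n] *)
Let z_ n x := (F n x - f x) / a n x.
Let z x := (F' x - f x) / a' x.
Let h x := (M + `|f x|) / alpha.

Let a'_ge x : D x -> alpha <= a' x.
Proof.
move=> Dx; apply: (cvgr_to_ge (a_cvg Dx)).
by apply: nearW => n; exact: a_ge.
Qed.

Let mf : measurable_fun D f. Proof. by case: f2. Qed.

Let mind n : measurable_fun D (\1_(A n) : T -> R).
Proof. by apply: measurable_funTS; exact: measurable_indic. Qed.

Let mz_ n : measurable_fun D (z_ n).
Proof.
apply: measurable_fun_divr => //; first exact: measurable_funB.
by move=> x Dx; rewrite (lt_le_trans alpha0)// a_ge.
Qed.

Let z_cvg x : D x -> z_ n x @[n --> \oo] --> z x.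
Proof.
move=> Dx; apply: cvgM; first by apply: cvgB; [exact: F_cvg|exact: cvg_cst].
by apply: cvgV; [rewrite gt_eqF// (lt_le_trans alpha0)// a'_ge|exact: a_cvg].
Qed.

Let mz : measurable_fun D z. Proof. exact: measurable_fun_cvg z_cvg. Qed.

Let z_le n x : D x -> `|z_ n x| <= h x.
Proof.
move=> Dx; rewrite /z_ /h normrM ler_pM//.
  by rewrite (le_trans (ler_normB _ _))// lerD2r F_le.
have a0 : 0 < a n x by rewrite (lt_le_trans alpha0)// a_ge.
by rewrite normfV gtr0_norm// lef_pV2 ?posrE// a_ge.
Qed.

Let zl_le x : D x -> `|z x| <= h x.
Proof.
move=> Dx.
have : `|z_ n x| @[n --> \oo] --> `|z x| by apply: cvg_norm; exact: z_cvg.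
by move=> /cvgr_to_le; apply; apply: nearW => n; exact: z_le.
Qed.

Let h2 : sq_integrable mu D h.
Proof.
rewrite (_ : h = (fun x => alpha^-1 * (cst M \+ (fun x => `|f x|)) x)); last first.
  by apply/funext => x; rewrite /h mulrC.
apply: sq_integrableZ => //; apply: sq_integrableD => //.
  exact: sq_integrable_cst.
by apply: sq_integrable_dom f2 _ => // [|x _]; [exact: measurableT_comp|rewrite normr_id].
Qed.

Let h_ge0 x : D x -> 0 <= h x.
Proof. by move=> Dx; exact: le_trans (zl_le Dx). Qed.

Let z2 : sq_integrable mu D z.
Proof.
apply: sq_integrable_dom h2 _ => // x Dx.
by rewrite (le_trans (zl_le Dx))// ler_norm.
Qed.

Let indB_le n x : D x -> `|\1_(A n) x * (z_ n x - z x)| <= 2 * h x.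
Proof.
move=> Dx; rewrite indicE; case: (_ \in _); rewrite ?mul1r ?mul0r ?normr0.
  by rewrite (le_trans (ler_normB _ _))// mulr2n mulrDl mul1r lerD ?z_le ?zl_le.
by rewrite mulr_ge0// h_ge0.
Qed.

Let indB_cvg x : D x -> \1_(A n) x * (z_ n x - z x) @[n --> \oo] --> 0.
Proof.
move=> Dx; apply/cvgr0Pnorm_le => e e0.
have /cvgr0Pnorm_le /(_ _ e0) : z_ n x - z x @[n --> \oo] --> 0.
  by apply/subr_cvg0; exact: z_cvg.
apply: filterS => n; apply: le_trans; rewrite indicE.
by case: (_ \in _); rewrite ?mul1r ?mul0r ?normr0.
Qed.

Let X_norm_le1 x : D x -> `|X x| <= 1.
Proof.
move=> Dx; have /andP[cX X1] := X_bd Dx.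
by rewrite ger0_norm// (le_trans (ltW c0)).
Qed.

Let Xz2 : sq_integrable mu D (X \* z).
Proof.
apply: sq_integrable_dom z2 _ => //; first exact: measurable_funM.
by move=> x Dx; rewrite /= normrM ler_piMl// X_norm_le1.
Qed.

Let uz_ae n : {ae mu, forall x, D x -> \1_(A n) x * u n x = \1_(A n) x * z_ n x}.
Proof.
apply: filterS (u_eq n) => x ux Dx; rewrite indicE.
have [xA|_] := boolP (x \in A n); last by rewrite !mul0r.
rewrite !mul1r /z_ -ux//; last exact/set_mem.
by rewrite mulrAC mulfV ?mul1r// gt_eqF// (lt_le_trans alpha0)// a_ge.
Qed.

(** Split [1_A u = 1_A z_ = 1_A (z_ - z) + 1_A z]: against [phi] the first term
    tends to 0 by dominated convergence, and the second one tends to the pairing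
    of [X * z] with [phi] by weak-star convergence of [1_A]. *)
Let pairing phi : sq_integrable mu D phi ->
  \int[mu]_(x in D) (uA x * phi x) = \int[mu]_(x in D) (X x * z x * phi x).
Proof.
move=> phi2; have mphi := phi2.1.
have mzz n : measurable_fun D (fun x => \1_(A n) x * (z_ n x - z x)).
  by apply: measurable_funM => //; exact: measurable_funB.
have izphi : mu.-integrable D (EFin \o (z \* phi)) by exact: sq_integrable_mul.
have i1 n : mu.-integrable D
    (EFin \o (fun x => \1_(A n) x * (z_ n x - z x) * phi x)).
  have b2 : sq_integrable mu D (fun x => \1_(A n) x * (z_ n x - z x)).
    apply: sq_integrable_dom (sq_integrableZ mD 2 h2) _ => // x Dx.
    by rewrite [leRHS]ger0_norm ?indB_le// mulr_ge0 ?h_ge0.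
  exact: (sq_integrable_mul mD b2 phi2).
have i2 n : mu.-integrable D (EFin \o (fun x => \1_(A n) x * (z x * phi x))).
  apply: (integrable_dom mD _ (integrable_norm izphi)).
    by apply: measurable_funM => //; exact: measurable_funM.
  by move=> x Dx /=; rewrite indicE; case: (_ \in _); rewrite ?mul1r ?mul0r ?normr0.
have sE n : \int[mu]_(x in D) (\1_(A n) x * u n x * phi x) =
    \int[mu]_(x in D) (\1_(A n) x * (z_ n x - z x) * phi x) +
    \int[mu]_(x in D) (\1_(A n) x * (z x * phi x)).
  rewrite -RintegralD//; congr fine; apply: ae_eq_integral => //.
  - by apply/measurable_EFinP; do 2 apply: measurable_funM => //.
  - apply/measurable_EFinP/measurable_funD; apply: measurable_funM => //.
    exact: measurable_funM.
  - apply: filterS (uz_ae n) => x uz Dx; rewrite uz//; congr EFin; ring.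
have lim1 : \int[mu]_(x in D) (\1_(A n) x * (z_ n x - z x) * phi x) @[n --> \oo]
    --> 0.
  have <- : \int[mu]_(x in D) (0 : R) = 0 by rewrite Rintegral_cst// mul0r.
  apply: (dominated_cvgR mD (g := fun x => 2 * h x * `|phi x|) _ _ _ _).2.
  - by move=> n; exact: measurable_funM.
  - by move=> x Dx; rewrite -(mul0r (phi x)); apply: cvgM; [exact: indB_cvg|exact: cvg_cst].
  - apply: (sq_integrable_mul mD (sq_integrableZ mD 2 h2)).
    by apply: sq_integrable_dom phi2 _ => // [|x _]; [exact: measurableT_comp|rewrite normr_id].
  - by move=> n x Dx; rewrite normrM ler_wpM2r// indB_le.
have lim2 := A_weak izphi.
have := uA_weak phi2; under eq_fun do rewrite sE.
move=> /cvg_unique -/(_ _ _ (cvgD lim1 lim2)) ->//; rewrite add0r.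
by apply: eq_Rintegral => x _; rewrite mulrA.
Qed.

(** The difference [uA - X * z] is itself an admissible test function. *)
Let uA_eq : {ae mu, forall x, D x -> uA x = X x * z x}.
Proof.
have d2 : sq_integrable mu D (uA \- X \* z).
  apply: sq_integrableD => //.
  apply: (sq_integrable_dom mD _ Xz2); first exact/measurable_funN/(Xz2.1).
  by move=> x _; rewrite /= normrN.
have i0 : \int[mu]_(x in D) ((uA x - X x * z x) ^+ 2) = 0.
  rewrite (@eq_Rintegral _ _ _ _ _ (fun x => uA x * (uA \- X \* z) x -
      X x * z x * (uA \- X \* z) x)); last by move=> x _ /=; ring.
  rewrite RintegralB//; last 2 first.
  - exact: (sq_integrable_mul mD uA2 d2).
  - exact: (sq_integrable_mul mD Xz2 d2).
  by rewrite pairing// subrr.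
have [md id] := d2.
have : ae_eq mu D (fun x => ((uA x - X x * z x) ^+ 2)%:E) (cst 0%E).
  apply/(ae_eq_integral_abs mu mD) => //.
    by have /integrableP[] := id.
  under eq_integral do rewrite gee0_abs ?lee_fin ?sqr_ge0//.
  by rewrite -[LHS]fineK ?integrable_fin_num// [fine _]i0.
apply: filterS => x /[apply] /eqP.
by rewrite eqe expf_eq0/= subr_eq0 => /eqP.
Qed.

(** The quotients [z_ n] converge strongly because their coefficients converge
    pointwise under a common bound; the weak limit of [1_A u] is [X * z], so that
    [uA / X] is nothing but the limit [z] of these quotients. *)
Lemma one_phase_strong_cvg :
  (\int[mu]_(x in D) ((\1_(A n) x * (u n x - uA x / X x)) ^+ 2)%:E)%E
    @[n --> \oo] --> 0%E.
Proof.
have E n : (\int[mu]_(x in D) ((\1_(A n) x * (u n x - uA x / X x)) ^+ 2)%:E =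
    \int[mu]_(x in D) ((\1_(A n) x * (z_ n x - z x)) ^+ 2)%:E)%E.
  apply: ae_eq_integral => //.
  - apply: measurable_phase_error => //; first by case: uA2.
    by move=> x Dx; have /andP[/(lt_le_trans c0)] := X_bd Dx.
  - apply/measurable_EFinP/measurable_funX/measurable_funM => //.
    exact: measurable_funB.
  - apply: filterS2 (uz_ae n) uA_eq => x uz uAE Dx; congr (EFin (_ ^+ 2)).
    rewrite !mulrBr uz// uAE//; congr (_ - _ * _).
    rewrite mulrAC mulfV ?mul1r// gt_eqF//.
    by have /andP[/(lt_le_trans c0)] := X_bd Dx.
under eq_fun do rewrite E.
have <- : (\int[mu]_(x in D) (0%:E : \bar R) = 0)%E by rewrite integral0.
have [m4 i4] := sq_integrableZ mD 2 h2.
apply: (dominated_cvgR mD _ _ i4 _).1.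
- move=> n; apply/measurable_funX/measurable_funM => //.
  exact: measurable_funB.
- move=> x Dx; rewrite -[0](expr0n _ 2); under eq_fun do rewrite expr2.
  by rewrite expr2; apply: cvgM; exact: indB_cvg.
- move=> n x Dx; rewrite ger0_norm ?sqr_ge0// -[leLHS]real_normK ?num_real//.
  by rewrite lerXn2r ?nnegrE ?indB_le// mulr_ge0 ?h_ge0.
Qed.

End OnePhase.

(** * An L1 bound from a pointwise convergent majorant *)

Lemma near_le_bounded (R : realType) (t : R^nat) (M : R) :
  (\forall n \near \oo, t n <= M) -> exists M', forall n, t n <= M'.
Proof.
move=> [N _ tM]; exists (Num.max M (\big[Num.max/0]_(i < N) t i)) => n.
rewrite le_max; have [Nn|nN] := leqP N n; first by rewrite tM.
by rewrite (le_bigmax _ (fun i : 'I_N => t i) (Ordinal nN)) orbT.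
Qed.

Section L1Bound.
Context d (T : measurableType d) (R : realType).
Variables (mu : {measure set T -> \bar R}) (D : set T).
Hypothesis mD : measurable D.
Hypothesis D_fin : (mu D < +oo)%E.
Variables (u F : (T -> R)^nat) (f F' : T -> R) (alpha C C' : R).
Let t n := \int[mu]_(x in D) `|u n x|.

(** The bound [C * t n] on [F n] is linear in the very quantity to be estimated,
    with a constant that need not be small. The gain comes from pointwise
    convergence: after division by [1 + t n] the differences [F n - F'] stay
    bounded and still tend to 0 pointwise, hence tend to 0 in L1. So the integral
    of [F n] is at most a constant plus an arbitrarily small multiple of [t n],
    and that multiple is absorbed by [alpha * t n]. *)
Lemma implicit_L1_bound :
  (forall n, mu.-integrable D (EFin \o u n)) ->
  mu.-integrable D (EFin \o f) ->
  (forall n, measurable_fun D (F n)) ->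
  (forall x, D x -> F n x @[n --> \oo] --> F' x) ->
  (forall n x, D x -> `|F n x| <= C * t n) ->
  (forall x, D x -> `|F' x| <= C') ->
  0 < alpha ->
  (forall n, {ae mu, forall x, D x -> alpha * `|u n x| <= `|F n x| + `|f x|}) ->
  exists M, forall n, t n <= M.
Proof.
move=> iu if_ mF FF' FC F'C alpha0 uF.
have t0 n : 0 <= t n by apply: Rintegral_ge0.
have t1 n : 0 < 1 + t n by rewrite ltr_pwDl.
have mF' : measurable_fun D F' by exact: measurable_fun_cvg FF'.
pose C2 := `|C| + `|C'|.
have C20 : 0 <= C2 by rewrite addr_ge0.
pose g n x := `|F n x - F' x| / (1 + t n).
have mg n : measurable_fun D (g n).
  apply: measurable_funM => //; apply: measurableT_comp => //.
  exact: measurable_funB.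
have g0 n x : 0 <= g n x by rewrite divr_ge0// ltW.
have gC n x : D x -> g n x <= C2.
  move=> Dx; rewrite /g ler_pdivrMr// (le_trans (ler_normB _ _))//.
  rewrite mulrDr mulr1 /C2; have := FC n _ Dx; have := F'C _ Dx.
  have := t0 n; have := ler_norm C; have := ler_norm C'; have := normr_ge0 C.
  have := normr_ge0 C'; nra.
have g_cvg x : D x -> g n x @[n --> \oo] --> 0.
  move=> Dx; apply/cvgr0Pnorm_le => e e0.
  have /cvgr0Pnorm_le/(_ _ e0) : F n x - F' x @[n --> \oo] --> 0.
    by apply/subr_cvg0; exact: FF'.
  apply: filterS => n; apply: le_trans; rewrite ger0_norm// /g.
  by rewrite ler_pdivrMr// ler_peMr// lerDl.
have iC2 : mu.-integrable D (EFin \o cst C2) by exact: integrable_cst_fin.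
have ig n : mu.-integrable D (EFin \o g n).
  by apply: (integrable_dom mD _ iC2) => // x Dx; rewrite ger0_norm// gC.
have int_g : \int[mu]_(x in D) g n x @[n --> \oo] --> 0.
  have <- : \int[mu]_(x in D) (0 : R) = 0 by rewrite Rintegral_cst// mul0r.
  apply: (dominated_cvgR mD mg g_cvg iC2 _).2 => n x Dx.
  by rewrite ger0_norm// gC.
have iF' : mu.-integrable D (EFin \o F').
  by apply: (integrable_dom mD mF' (integrable_cst_fin mD D_fin C')).
have inF' := integrable_norm iF'; have inf := integrable_norm if_.
pose K := \int[mu]_(x in D) (`|F' x| + `|f x|).
have iK : mu.-integrable D (EFin \o (fun x => `|F' x| + `|f x|)).
  exact: (integrableD mD inF' inf).
have tK n : alpha * t n <= (1 + t n) * \int[mu]_(x in D) g n x + K.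
  rewrite /t -RintegralZl//; last exact: integrable_norm.
  rewrite -RintegralZl// -RintegralD//; last exact: (integrableZl mD (1 + t n) (ig n)).
  have i3 : mu.-integrable D
      (EFin \o (fun x => (1 + t n) * g n x + (`|F' x| + `|f x|))).
    exact: (integrableD mD (integrableZl mD (1 + t n) (ig n)) iK).
  have i4 : mu.-integrable D (EFin \o (fun x => alpha * `|u n x|)).
    exact: (integrableZl mD alpha (integrable_norm (iu n))).
  apply: fine_le; [exact: integrable_fin_num..|].
  have /integrableP[m3 _] := i3; have /integrableP[m4 _] := i4.
  apply: (ae_ge0_le_integral mD _ m4 _ m3).
  - by move=> x Dx; rewrite lee_fin mulr_ge0// ltW.
  - by move=> x Dx; rewrite lee_fin addr_ge0// ?addr_ge0// mulr_ge0// ltW.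
  apply: filterS (uF n) => x ux Dx; rewrite lee_fin (le_trans (ux Dx))//.
  rewrite /g mulrCA mulfV ?mulr1 ?gt_eqF// addrA lerD2r.
  by rewrite -lerBlDr lerB_dist.
(* with the integral of [g n] below [alpha / 2], half of [alpha * t n] remains *)
have a2 : 0 < alpha / 2 by rewrite divr_gt0.
apply: (@near_le_bounded _ _ (1 + 2 * K / alpha)).
move/cvgr0Pnorm_le : int_g => /(_ _ a2); apply: filterS => n.
rewrite ger0_norm; last exact: Rintegral_ge0.
move: (\int[mu]_(x in D) g n x) (tK n) => e en ea.
have : alpha * t n <= alpha + 2 * K.
  have : (1 + t n) * e <= (1 + t n) * (alpha / 2) by rewrite ler_wpM2l// ltW.
  nra.
move=> h; rewrite -(ler_pM2l alpha0) mulrDr mulr1 (mulrC alpha (_ / _)).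
by rewrite divfK// gt_eqF.
Qed.

End L1Bound.

(** * Lebesgue measure on the space of row vectors *)

Lemma countType_bigcup_measurable d (T : sigmaRingType d) (I : countType)
    (P : set I) (F : I -> set T) :
  (forall i, P i -> measurable (F i)) -> measurable (\bigcup_(i in P) F i).
Proof.
move=> mF; rewrite bigcup_mkcond; apply: countable_bigcupT_measurable.
  exact: countableP.
by move=> i; case: ifPn => // /[!inE]; exact: mF.
Qed.

Section LebesgueRn.
Variables (R : realType) (N : nat).
Local Notation V := ('rV[R]_N.+1).
Local Notation leb := (leb R N).

Lemma leb_le (A B : set V) : A `<=` B -> (leb A <= leb B)%E.
Proof. exact: (le_outer_measure (@lebesgue_outer R N)). Qed.

(** Clamping the [i]-th sides of a box by [min] and [max] with [t] cuts it into two
    boxes, which cover its parts in and outside the half-space. Their volumes add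
    up exactly, since [min x t + max x t = x + t]; so a cover of any set splits
    into covers of its two parts with the same total volume. *)
Lemma measurable_halfspace (i : 'I_N.+1) (t : R) :
  measurable ([set x : V | x ord0 i <= t] : set (Rn R N)).
Proof.
apply: le_caratheodory_measurable => /= X.
apply: le_ereal_inf_tmp => _ [c [cle cX] <-].
pose lo (ab : V * V) : V * V :=
  (\row_j (if j == i then Num.min (ab.1 ord0 j) t else ab.1 ord0 j),
   \row_j (if j == i then Num.min (ab.2 ord0 j) t else ab.2 ord0 j)).
pose hi (ab : V * V) : V * V :=
  (\row_j (if j == i then Num.max (ab.1 ord0 j) t else ab.1 ord0 j),
   \row_j (if j == i then Num.max (ab.2 ord0 j) t else ab.2 ord0 j)).
have lole k j : (lo (c k)).1 ord0 j <= (lo (c k)).2 ord0 j.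
  by rewrite !mxE; case: eqP => // _; rewrite le_min !ge_min cle lexx !orbT.
have hile k j : (hi (c k)).1 ord0 j <= (hi (c k)).2 ord0 j.
  by rewrite !mxE; case: eqP => // _; rewrite ge_max !le_max cle lexx !orbT.
have vol_ge0 (ab : V * V) : (forall j, ab.1 ord0 j <= ab.2 ord0 j) ->
    (0 <= box_volume ab)%E.
  by move=> abj; rewrite lee_fin; apply: prodr_ge0 => j _; rewrite subr_ge0.
have volE k : (box_volume (c k) = box_volume (lo (c k)) + box_volume (hi (c k)))%E.
  rewrite /box_volume -EFinD (bigD1 i)//= [in RHS](bigD1 i)//=.
  rewrite [X in _ = (_ + X)%:E](bigD1 i)//= !mxE !eqxx.
  have pE (ab : V * V) (ab' : V * V) :
      (forall j, j != i -> ab'.1 ord0 j = ab.1 ord0 j) ->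
      (forall j, j != i -> ab'.2 ord0 j = ab.2 ord0 j) ->
      \prod_(j | j != i) (ab'.2 ord0 j - ab'.1 ord0 j) =
      \prod_(j | j != i) (ab.2 ord0 j - ab.1 ord0 j).
    by move=> h1 h2; apply: eq_bigr => j ji; rewrite h1// h2.
  rewrite (pE (c k) (lo (c k))); last 2 first.
    by move=> j /negbTE ji; rewrite mxE ji.
    by move=> j /negbTE ji; rewrite mxE ji.
  rewrite (pE (c k) (hi (c k))); last 2 first.
    by move=> j /negbTE ji; rewrite mxE ji.
    by move=> j /negbTE ji; rewrite mxE ji.
  rewrite -mulrDl; congr (_ * _)%:E.
  have h (x : R) : Num.min x t = x + t - Num.max x t.
    by rewrite -(addr_max_min x t) addrAC subrr add0r.
  by rewrite !h; ring.
under eq_eseriesr do rewrite volE.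
rewrite nneseriesD; [|by move=> k _ _; exact: vol_ge0..].
apply: leeD; apply: ereal_inf_lbound; [exists (lo \o c)|exists (hi \o c)] => //.
- split => // x [Xx /= xt]; have [k _ bx] := cX _ Xx; exists k => // j.
  have /andP[ax xb] := bx j; rewrite !mxE; case: eqP => [ji|_]; last by rewrite ax xb.
  by rewrite ge_min le_min ax xb /= ji.
- split => // x [Xx /negP]; rewrite -ltNge => xt.
  have [k _ bx] := cX _ Xx; exists k => // j.
  have /andP[ax xb] := bx j; rewrite !mxE; case: eqP => [ji|_]; last by rewrite ax xb.
  by rewrite ge_max le_max ax xb /= ji ltW.
Qed.

Lemma measurable_coord (i : 'I_N.+1) :
  measurable_fun setT (fun x : Rn R N => (x : V) ord0 i).
Proof.
move=> mT; apply: (measurability _ (RGenOInfty.measurableE R)) => //.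
move=> /= _ [_ [a ->] <-]; rewrite setTI.
rewrite (_ : _ @^-1` _ = ~` [set x : V | x ord0 i <= a]).
  by apply: measurableC; exact: measurable_halfspace.
apply/seteqP; split => x /=; rewrite in_itv/= andbT.
  by move=> ax; apply/negP; rewrite -ltNge.
by move=> /negP; rewrite -ltNge.
Qed.

Lemma rV_ballP (x y : V) (e : R) : 0 < e ->
  ball x e y <-> forall i, ball (x ord0 i) e (y ord0 i).
Proof.
by move=> e0; split => [[_ xy] i|xy]; [|split => // i j; rewrite ord1].
Qed.

Lemma measurable_mxball (x : V) (e : R) : 0 < e ->
  measurable (ball x e : set (Rn R N)).
Proof.
move=> e0; rewrite (_ : ball x e = \bigcap_(i in [set: 'I_N.+1])
   ((fun y : V => y ord0 i) @^-1` ball (x ord0 i) e)).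
  apply: fin_bigcap_measurable => // i _.
  by rewrite -[X in measurable X]setTI; apply: measurable_coord => //; exact: measurable_ball.
by apply/seteqP; split => y /= => [/(rV_ballP _ _ e0) + i _|xy];
  [exact|apply/rV_ballP => // i; exact: xy].
Qed.

(** A countable basis of the topology; it makes open sets of the space, and of its
    square for the product sigma-algebra, measurable. *)
Definition rat_ball (p : 'rV[rat]_N.+1 * nat) : set V :=
  ball (map_mx ratr p.1 : V) p.2.+1%:R^-1.

Lemma measurable_rat_ball p : measurable (rat_ball p : set (Rn R N)).
Proof. exact: measurable_mxball. Qed.

Lemma rat_ball_basis (x : V) (e : R) : 0 < e ->
  exists p, rat_ball p x /\ rat_ball p `<=` ball x e.
Proof.
move=> e0; have [n ne] : exists n : nat, n.+1%:R^-1 < e / 2.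
  have [n _ /(_ n (leqnn n))] := near_infty_natSinv_lt (PosNum (divr_gt0 e0 (ltr0Sn R 1))).
  by exists n.
pose r : R := n.+1%:R^-1.
have r0 : 0 < r by rewrite invr_gt0 ltr0n.
have /choice [q qx] : forall i, exists q : rat,
    ball (x ord0 i) r (ratr q : R).
  move=> i; have : x ord0 i - r < x ord0 i + r by rewrite ltrBlDr -addrA ltrDl addr_gt0.
  move/rat_in_itvoo => [q]; rewrite in_itv/= => qi; exists q.
  by rewrite /ball/= ltr_distlC.
exists (\row_i q i, n); split.
  by apply/rV_ballP => // i; rewrite !mxE; apply: ball_sym; exact: qx.
move=> y qy; apply: (@le_ball _ _ _ (r + r)).
  by have := ltW ne; rewrite -/r; lra.
apply: (@ball_triangle _ _ (map_mx ratr (\row_i q i) : V)) => //.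
by apply/rV_ballP => // i; rewrite !mxE; exact: qx.
Qed.

Lemma measurable_open (U : set V) : open U -> measurable (U : set (Rn R N)).
Proof.
move=> oU; rewrite (_ : U = \bigcup_(p in [set p | rat_ball p `<=` U]) rat_ball p).
  by apply: countType_bigcup_measurable => // p _; exact: measurable_rat_ball.
apply/seteqP; split => [x Ux|x [p /= pU px]]; last exact: pU.
have : nbhs x U by exact: open_nbhs_nbhs.
rewrite -nbhs_ballE => -[e e0 eU].
by have [p [px pe]] := rat_ball_basis x e0; exists p => //=; exact: subset_trans eU.
Qed.

Lemma measurable_open2 (U : set (V * V)) : open U ->
  measurable (U : set (Rn R N * Rn R N)).
Proof.
move=> oU; rewrite (_ : U = \bigcup_(p in [set p | rat_ball p.1 `*` rat_ball p.2 `<=` U])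
   (rat_ball p.1 `*` rat_ball p.2)).
  by apply: countType_bigcup_measurable => // p _; apply: measurableX; exact: measurable_rat_ball.
apply/seteqP; split => [x Ux|x [p /= pU px]]; last exact: pU.
have : nbhs x U by exact: open_nbhs_nbhs.
rewrite -nbhs_ballE => -[e e0 eU].
have [p [px pe]] := rat_ball_basis x.1 e0.
have [q [qx qe]] := rat_ball_basis x.2 e0.
exists (p, q) => //= y [y1 y2]; apply: eU; split; [exact: pe|exact: qe].
Qed.

Lemma measurable_continuous2 (f : V * V -> R) : continuous f ->
  measurable_fun setT (f : Rn R N * Rn R N -> R).
Proof.
move=> cf mT; apply: (measurability _ (RGenOInfty.measurableE R)) => //.
move=> /= _ [_ [a ->] <-]; rewrite setTI.
apply: measurable_open2; apply: open_comp => // x _; exact: cf.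
Qed.

Lemma leb_ball_fin (e : R) : 0 < e -> (leb (ball (0%R : V) e) < +oo)%E.
Proof.
move=> e0; pose c k : V * V :=
  if k is 0%N then (const_mx (- e), const_mx e) else (0, 0).
(* a single box, completed by degenerate ones, covers the ball *)
apply: (@le_lt_trans _ _ (\sum_(k <oo) box_volume (c k))%E).
  apply: ereal_inf_lbound; exists c => //.
  split => [[|k] i|x xe]; [rewrite /= !mxE|by rewrite /= !mxE|].
    by rewrite (le_trans _ (ltW e0))// oppr_le0 ltW.
  exists 0%N => // i; rewrite !mxE.
  have /(rV_ballP _ _ e0) /(_ i) := xe; rewrite /ball/= mxE sub0r normrN => /ltW.
  by rewrite ler_norml.
have v0 k : (0 <= box_volume (c k))%E.
  rewrite lee_fin; apply: prodr_ge0 => i _; case: k => [|k]; rewrite !mxE ?subrr//.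
  by rewrite opprK addr_ge0// ltW.
rewrite (nneseriesD1 (n := 0%N))//= eseries0 ?adde0 ?ltry// => k _ /=.
by case: k => // k _; rewrite /box_volume big_ord_recl subrr mul0r.
Qed.

Lemma bounded_in_closed_ball (D : set V) : bounded_set D ->
  exists M, D `<=` [set x | `|x| <= M].
Proof.
move=> [M [_ /(_ (`|M| + 1))]]; rewrite ltr_pwDr ?ler_norm// => /(_ isT) DM.
by exists (`|M| + 1).
Qed.

Lemma leb_bounded_fin (D : set V) : bounded_set D -> (leb D < +oo)%E.
Proof.
move=> /bounded_in_closed_ball[M DM].
have M0 : 0 < `|M| + 1 by rewrite ltr_pwDr.
apply: (le_lt_trans (leb_le _) (leb_ball_fin M0)) => x /DM /= xM.
rewrite -ball_normE /ball_/= sub0r normrN (le_lt_trans xM)//.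
by rewrite (le_lt_trans (ler_norm M))// ltrDl.
Qed.

Lemma leb_sigma_finite : sigma_finite setT leb.
Proof.
exists (fun k => ball (0 : V) k.+1%:R).
  apply/seteqP; split => // x _.
  have [n xn] : exists n : nat, `|x| < n.+1%:R.
    exists (Num.truncn `|x|); exact: truncnS_gt.
  by exists n => //; rewrite -ball_normE /ball_/= sub0r normrN.
by move=> k; split; [exact: measurable_mxball|exact: leb_ball_fin].
Qed.

Lemma leb_translate (x : V) (A : set V) : (leb [set y | A (x + y)%R] <= leb A)%E.
Proof.
apply: le_ereal_inf_tmp => _ [c [cle cA] <-].
apply: ereal_inf_lbound; exists (fun k => ((c k).1 - x, (c k).2 - x)).
  split => [k i|y /= /cA[k _ cy]]; first by rewrite !mxE lerD2r.
  by exists k => // i; have := cy i; rewrite !mxE lerBlDl lerBrDl.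
apply: eq_eseriesr => k _; congr EFin; apply: eq_bigr => i _.
by rewrite !mxE; ring.
Qed.

Lemma leb_ball_center (x y : V) (e : R) : (leb (ball x e) <= leb (ball y e))%E.
Proof.
apply: le_trans (leb_translate (y - x) _); apply: leb_le => z /=.
rewrite -!ball_normE /ball_/=; congr (`|_| < _).
by rewrite opprD addrA opprB addrCA subrr addr0.
Qed.

(** Countably many translates of a ball cover the space, so a null ball would make
    the whole space null. *)
Lemma leb_ball_gt0 (x : V) (e : R) : 0 < e -> (0 < leb setT)%E ->
  (0 < leb (ball x e))%E.
Proof.
move=> e0; rewrite !lt0e !measure_ge0 !andbT; apply: contra => /eqP x0.
rewrite eq_le measure_ge0 andbT.
pose F k : set V := if unpickle k is Some q
  then ball (map_mx ratr q : V) e else set0.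
have F0 k : leb (F k) = 0%E.
  rewrite /F; case: unpickle => [q|]; last exact: measure0.
  by apply/eqP; rewrite eq_le measure_ge0 andbT -x0 leb_ball_center.
apply: (le_trans (leb_le (B := \bigcup_k F k) _)).
  move=> y _; have [[q n] [qy qe]] := rat_ball_basis y e0.
  exists (pickle q) => //; rewrite /F pickleK; apply: ball_sym; apply: qe.
  by apply: ballxx; rewrite invr_gt0 ltr0n.
apply: (le_trans (outer_measure_sigma_subadditive (@lebesgue_outer R N) F)).
by rewrite eseries0// => k _ _; exact: F0.
Qed.

End LebesgueRn.

(** * Continuous kernels *)

(** A named copy of the measure that carries the sigma-finite structure on which
    Tonelli's theorem rests. *)
Definition leb_sf (R : realType) (N : nat) : set (Rn R N) -> \bar R := leb R N.

HB.instance Definition _ (R : realType) (N : nat) :=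
  isMeasure.Build _ _ _ (@leb_sf R N) (measure0 (leb R N)) (measure_ge0 (leb R N))
    (@measure_semi_sigma_additive _ _ _ (leb R N)).

HB.instance Definition _ (R : realType) (N : nat) :=
  Measure_isSigmaFinite.Build _ _ _ (@leb_sf R N) (leb_sigma_finite R N).

Section Kernel.
Variables (R : realType) (N : nat).
Local Notation V := ('rV[R]_N.+1).
Local Notation leb := (leb R N).

Lemma measurable_kernel_integral_ge0 (k : V -> V -> R) (g : Rn R N -> R) :
  continuous (fun p : V * V => k p.1 p.2) ->
  (forall x y, 0 <= k x y) -> measurable_fun setT g -> (forall y, 0 <= g y) ->
  measurable_fun setT (fun x : Rn R N => \int[leb]_y (k x y * g y)).
Proof.
move=> ck k0 mg g0.
pose h (p : Rn R N * Rn R N) : \bar R := (k p.1 p.2 * g p.2)%:E.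
have mh : measurable_fun setT h.
  apply/measurable_EFinP/measurable_funM; first exact: measurable_continuous2.
  by apply: measurableT_comp => //.
have mF : measurable_fun setT (fun x : Rn R N => (\int[leb]_y h (x, y))%E).
  apply: (@measurable_fun_fubini_tonelli_F _ _ _ _ R (@leb_sf R N) h mh) => p.
  by rewrite lee_fin mulr_ge0.
exact: measurableT_comp.
Qed.

Lemma measurable_kernel_section (k : V -> V -> R) (x : V) :
  continuous (fun p : V * V => k p.1 p.2) ->
  measurable_fun setT (k x : Rn R N -> R).
Proof.
move=> ck; apply: (measurable_fun_pair2 (f := fun p : Rn R N * Rn R N => k p.1 p.2)).
exact: measurable_continuous2.
Qed.

Lemma measurable_kernel_integral (D : set (Rn R N)) (k : V -> V -> R)
    (g : Rn R N -> R) :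
  continuous (fun p : V * V => k p.1 p.2) ->
  (forall x y, 0 <= k x y) -> measurable_fun setT g ->
  (forall x, D x -> leb.-integrable setT (EFin \o (fun y => k x y * g y))) ->
  measurable_fun D (fun x : Rn R N => \int[leb]_y (k x y * g y)).
Proof.
move=> ck k0 mg ig.
have mp := measurable_funrpos mg; have mn := measurable_funrneg mg.
have gp0 y : 0 <= g^\+ y by exact: funrpos_ge0.
have gn0 y : 0 <= g^\- y by exact: funrneg_ge0.
have mI : measurable_fun D (fun x => \int[leb]_y (k x y * g^\+ y) -
    \int[leb]_y (k x y * g^\- y)).
  apply: measurable_funTS.
  exact: (measurable_funB (measurable_kernel_integral_ge0 ck k0 mp gp0)
    (measurable_kernel_integral_ge0 ck k0 mn gn0)).
apply: eq_measurable_fun mI => x /set_mem Dx.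
have mk := measurable_kernel_section x ck.
have g_le y : g^\+ y <= `|g y| /\ g^\- y <= `|g y|.
  rewrite /funrpos /funrneg !ge_max normr_ge0 ler_norm -normrN ler_norm.
  by [].
rewrite -RintegralB//.
- by apply: eq_Rintegral => y _; rewrite -mulrBr -[in RHS](funrposBneg g).
- apply: (integrable_dom measurableT _ (integrable_norm (ig _ Dx))).
    exact: (measurable_funM mk mp).
  move=> y _ /=; rewrite !normrM ler_wpM2l// ger0_norm ?gp0//.
  exact: (g_le y).1.
- apply: (integrable_dom measurableT _ (integrable_norm (ig _ Dx))).
    exact: (measurable_funM mk mn).
  move=> y _ /=; rewrite !normrM ler_wpM2l// ger0_norm ?gn0//.
  exact: (g_le y).2.
Qed.

Lemma integrable_kernel (k : V -> V -> R) (x : V) : admissible_kernel k ->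
  leb.-integrable setT (EFin \o (k x : Rn R N -> R)).
Proof.
move=> [ck k0 _ _ k1]; apply/integrableP; split.
  by apply/measurable_EFinP; exact: measurable_kernel_section.
under eq_integral do rewrite gee0_abs ?lee_fin//.
by rewrite k1 ltry.
Qed.

(** A null space could not carry a kernel of integral 1. *)
Lemma leb_setT_gt0 (k : V -> V -> R) : admissible_kernel k ->
  (0 < leb setT)%E.
Proof.
move=> kk; rewrite lt0e measure_ge0 andbT; apply/eqP => leb0.
have /integrableP[mk _] := integrable_kernel 0 kk.
have := kernel_integral1 kk 0.
rewrite [X in X = _](null_set_integral measurableT mk leb0).
by move=> /eqP; rewrite eq_sym onee_eq0.
Qed.

Lemma compact_closed_ball (M : R) : compact [set x : V | `|x| <= M].
Proof.
apply: bounded_closed_compact.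
  exists M; split => // [|M' MM' x /= xM]; first exact: num_real.
  by rewrite (le_trans xM)// ltW.
rewrite (_ : [set _ | _] = (fun x : V => `|x|) @^-1` [set r | r <= M])//.
apply: closed_comp => [x _|]; last exact: closed_le.
exact: norm_continuous.
Qed.

Lemma kernel_bounded (k : V -> V -> R) (D : set V) :
  continuous (fun p : V * V => k p.1 p.2) -> bounded_set D ->
  exists C, forall x y, D x -> D y -> `|k x y| <= C.
Proof.
move=> ck /bounded_in_closed_ball[M DM].
have cK := compact_setX (compact_closed_ball (M := M)) (compact_closed_ball (M := M)).
have /compact_bounded[C [_ HC]] : compact ((fun p : V * V => k p.1 p.2) @`
    ([set x : V | `|x| <= M] `*` [set x : V | `|x| <= M])).
  apply: continuous_compact => //; apply: continuous_subspaceT => p; exact: ck.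
exists (`|C| + 1) => x y Dx Dy; apply: (HC (`|C| + 1)).
  by rewrite ltr_pwDr// ler_norm.
by exists (x, y) => //; split; exact: DM.
Qed.

(** The radius of the neighbourhood and the lower bound on it can be taken equal:
    a smaller number serves for both, and compactness makes it uniform in [x]. *)
Lemma kernel_near_diag (k : V -> V -> R) (D : set V) :
  continuous (fun p : V * V => k p.1 p.2) -> (forall x, 0 < k x x) ->
  bounded_set D ->
  exists2 e : R, 0 < e & forall x y, D x -> ball x e y -> e <= k x y.
Proof.
move=> ck k0 /bounded_in_closed_ball[M DM].
have /compact_near_coveringP := compact_closed_ball (M := M).
move=> /(_ R (0^'+) (fun e x => forall y, ball x e y -> e <= k x y) _) cov.
have {}cov : \forall e \near (0 : R)^'+, forall x, `|x| <= M ->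
    forall y, ball x e y -> e <= k x y.
  apply: cov => x _; have kx : \forall p \near (x, x), k x x / 2 < k p.1 p.2.
    by apply: (cvgr_gt _ (ck (x, x))); rewrite ltr_pdivrMr// ltr_pMr// ltr1n.
  move: kx => /nbhs_ballP[r /= r0 kr].
  have kr' y z : ball x r y -> ball x r z -> k x x / 2 < k y z.
    by move=> xy xz; apply: (kr (y, z)).
  near=> y e => /= z yz.
  have e1 : e <= r / 2 by near: e; apply: nbhs_right_le; rewrite divr_gt0.
  have e2 : e <= k x x / 2 by near: e; apply: nbhs_right_le; rewrite divr_gt0.
  have xy : ball x (r / 2) y by near: y; apply: nbhsx_ballx; rewrite divr_gt0.
  apply: (le_trans e2); apply/ltW/kr'.
    by apply: le_ball xy; lra.
  by rewrite (splitr r); apply: (ball_triangle xy); exact: le_ball yz.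
near (0 : R)^'+ => e; exists e; first by near: e; exact: nbhs_right_gt.
move=> x y Dx; apply: (near cov e) => //; exact: DM.
Unshelve. all: by end_near. Qed.

(** The lower bound does not depend on how [A] and [B] share the space: near the
    diagonal both kernels exceed some [e], so whatever set a point of the ball of
    radius [e] belongs to, it contributes at least [e] times its measure. *)
Lemma kernels_mass_ge (k1 k2 : V -> V -> R) (D : set V) :
  admissible_kernel k1 -> admissible_kernel k2 -> bounded_set D ->
  exists2 alpha : R, 0 < alpha & forall x (A B : set (Rn R N)), D x ->
    measurable A -> measurable B -> A `|` B = setT -> A `&` B = set0 ->
    alpha <= \int[leb]_(y in A) k1 x y + \int[leb]_(y in B) k2 x y.
Proof.
move=> ak1 ak2 bD.
have [e1 e10 ke1] := kernel_near_diag (kernel_continuous ak1) (kernel_diag_gt0 ak1) bD.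
have [e2 e20 ke2] := kernel_near_diag (kernel_continuous ak2) (kernel_diag_gt0 ak2) bD.
pose e := Num.min e1 e2.
have e0 : 0 < e by rewrite lt_min e10.
have bfin x : leb (ball x e) \is a fin_num.
  by rewrite ge0_fin_numE// (le_lt_trans (leb_ball_center x 0 e))// leb_ball_fin.
exists (e * fine (leb (ball (0 : V) e))).
  rewrite mulr_gt0// fine_gt0// leb_ball_gt0//=; last exact: leb_setT_gt0 ak1.
  by rewrite leb_ball_fin.
move=> x A B Dx mA mB ABT AB0.
(* [w] lies below both kernels, and its integral is the announced bound *)
pose w (y : Rn R N) : R := e * \1_(ball (x : V) e) y.
have mball : measurable (ball (x : V) e : set (Rn R N)) by exact: measurable_mxball.
have w0 y : 0 <= w y by rewrite mulr_ge0// ltW.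
have w_le y : w y <= k1 x y /\ w y <= k2 x y.
  rewrite /w indicE; case: (boolP (y \in _)) => [/set_mem xy|_];
    rewrite ?mulr0 ?mulr1.
    split; [apply: (le_trans _ (ke1 x y Dx _))|apply: (le_trans _ (ke2 x y Dx _))].
    by rewrite ge_min lexx.
    by apply: le_ball xy; rewrite ge_min lexx.
    by rewrite ge_min lexx orbT.
    by apply: le_ball xy; rewrite ge_min lexx orbT.
  by split; exact: kernel_ge0.
have iw : leb.-integrable setT (EFin \o w).
  apply: (integrable_dom measurableT _ (integrable_kernel x ak1)).
    by apply: measurable_funM => //; exact: measurable_indic.
  by move=> y _; rewrite ger0_norm// (w_le y).1.
have iS (E : set (Rn R N)) (g : Rn R N -> R) : measurable E ->
    leb.-integrable setT (EFin \o g) -> leb.-integrable E (EFin \o g).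
  by move=> mE; apply: integrableS.
have wE : \int[leb]_y w y = e * fine (leb (ball x e)).
  rewrite RintegralZl//; first by rewrite /Rintegral integral_indic// setIT.
  apply/integrableP; split; first by apply/measurable_EFinP; exact: measurable_indic.
  under eq_integral do rewrite gee0_abs ?lee_fin//.
  by rewrite integral_indic// setIT -ge0_fin_numE.
apply: (@le_trans _ _ (\int[leb]_y w y)).
  rewrite wE (ler_pM2l e0).
  exact: (fine_le (bfin 0) (bfin x) (leb_ball_center 0 x e)).
rewrite -ABT Rintegral_setU//; last 2 first.
- by rewrite ABT.
- exact/disj_set2P.
by apply: lerD; apply: le_Rintegral => //; [exact: iS|
  exact: iS (integrable_kernel x ak1)|by move=> y _; exact: (w_le y).1|exact: iS|
  exact: iS (integrable_kernel x ak2)|by move=> y _; exact: (w_le y).2].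
Qed.

End Kernel.

(** * The space L2 of the domain *)

Section L2.
Variables (R : realType) (N : nat) (D : set (Rn R N)).
Local Notation leb := (leb R N).
Hypothesis mD : measurable D.
Implicit Types g : Rn R N -> R.

Let sqr_patch g :
  (fun x => (g x ^+ 2)%:E) \_ D = EFin \o (fun x => (g \_ D) x ^+ 2) :> (_ -> \bar R).
Proof.
by apply/funext => x; rewrite /= !patchE; case: ifPn => // _; rewrite expr0n.
Qed.

Lemma L2_sq_integrable g : L2 D g -> sq_integrable leb D g.
Proof.
move=> gL2; split.
  by apply/(measurable_restrictT _ mD); have /= := set_mem (sub_Lfun_mfun gL2).
by apply/(integrable_mkcond _ mD); rewrite sqr_patch; exact: Lfun2_integrable_sqr.
Qed.

Lemma sq_integrable_L2 g : sq_integrable leb D g -> L2 D g.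
Proof.
move=> [mg ig]; rewrite /L2 inE; apply/andP; split; rewrite inE/=.
  exact/(measurable_restrictT _ mD).
rewrite /finite_norm unlock poweR_lty//.
move/(integrable_mkcond _ mD) : ig; rewrite sqr_patch => /integrableP[_].
apply: le_lt_trans; rewrite le_eqVlt; apply/orP; left; apply/eqP.
apply: eq_integral => x _ /=.
by rewrite normrX powR_mulrn.
Qed.

Lemma L2norm_cvg0 (g : (Rn R N -> R)^nat) :
  (\int[leb]_(x in D) (g n x ^+ 2)%:E)%E @[n --> \oo] --> 0%E ->
  L2norm D (g n) @[n --> \oo] --> 0%E.
Proof.
have E n : L2norm D (g n) = ((\int[leb]_(x in D) (g n x ^+ 2)%:E) `^ 2^-1)%E.
  rewrite /L2norm unlock [in RHS]integral_mkcond [in RHS]sqr_patch; congr poweR.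
  apply: eq_integral => x _ /=.
  by rewrite powR_mulrn// -normrX ger0_norm ?sqr_ge0.
move=> /fine_cvgP[I_fin I0]; under eq_fun do rewrite E.
apply/fine_cvgP; split.
  by apply: filterS I_fin => n; exact: fin_num_poweR.
rewrite [X in X @ _ --> _](_ : _ = fun n => Num.sqrt
    (fine (\int[leb]_(x in D) (g n x ^+ 2)%:E)%E)).
  by rewrite -[0]sqrtr0; apply: (cvg_comp _ _ I0); exact: sqrt_continuous.
apply/funext => n; rewrite /comp fine_poweR powR12_sqrt// fine_ge0//.
by apply: integral_ge0 => x _; rewrite lee_fin sqr_ge0.
Qed.

End L2.

(** * The balance equation on one phase *)

(** The kernels [k1] and [k2] are those by which a point of one fixed phase feels
    [A n] and [B n]: for the phase [A], [k1] acts inside it and [k2] is the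
    coupling; for the phase [B], [k1] is the coupling and [k2] acts inside. *)
Section Phase.
Variables (R : realType) (N : nat) (D : set (Rn R N)).
Local Notation leb := (leb R N).
Local Notation V := ('rV[R]_N.+1).
Hypothesis dD : bounded_domain (D : set 'rV[R]_N.+1).
Variables (k1 k2 : V -> V -> R).
Hypothesis ak1 : admissible_kernel k1.
Hypothesis ak2 : admissible_kernel k2.
Variables (A B : (set (Rn R N))^nat) (u : (Rn R N -> R)^nat) (X uA uB : Rn R N -> R).
Hypothesis mA : forall n, measurable (A n).
Hypothesis mB : forall n, measurable (B n).
Hypothesis ABT : forall n, A n `|` B n = setT.
Hypothesis AB0 : forall n, A n `&` B n = set0.
Hypothesis uW : forall n, W_Dir D (u n).
Hypothesis AX : weakstar_Linfty_cvg (fun n => \1_(A n)) X.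
Hypothesis uA_weak : weak_L2_cvg D (fun n => \1_(A n) \* u n) uA.
Hypothesis uB_weak : weak_L2_cvg D (fun n => \1_(B n) \* u n) uB.

Definition phase_mass n (x : V) : R :=
  \int[leb]_(y in A n) k1 x y + \int[leb]_(y in B n) k2 x y.

Definition phase_flux n (x : V) : R :=
  \int[leb]_(y in D) (\1_(A n) y * u n y * k1 x y) +
  \int[leb]_(y in D) (\1_(B n) y * u n y * k2 x y).

Definition phase_flux_lim (x : V) : R :=
  \int[leb]_(y in D) (uA y * k1 x y) + \int[leb]_(y in D) (uB y * k2 x y).

Let mD : measurable (D : set (Rn R N)).
Proof. by apply: measurable_open; case: dD. Qed.

Let D_bounded : bounded_set (D : set 'rV[R]_N.+1).
Proof. by case: dD. Qed.

Let D_fin : (leb D < +oo)%E.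
Proof. exact: leb_bounded_fin. Qed.

Lemma indic_partition n y : \1_(B n) y = 1 - \1_(A n) y :> R.
Proof.
rewrite !indicE; have [yA|yA] := boolP (y \in A n).
  rewrite memNset ?subrr// => yB.
  have : (A n `&` B n) y by split => //; exact/set_mem.
  by rewrite AB0.
rewrite mem_set ?subr0//; have : (A n `|` B n) y by rewrite ABT.
by case=> // /mem_set; rewrite (negbTE yA).
Qed.

(** The limit exists because each kernel section is an integrable test function
    for the weak-star convergence of the indicators. *)
Lemma phase_mass_cvg x : cvg (phase_mass n x @[n --> \oo]).
Proof.
case: AX => _ _ /(_ _ ((Lfun1_integrable _ _).2 (integrable_kernel x ak1))) c1.
case: AX => _ _ /(_ _ ((Lfun1_integrable _ _).2 (integrable_kernel x ak2))) c2.
have mk2 := integrable_kernel x ak2.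
rewrite (_ : phase_mass^~ x = fun n => \int[leb]_y (\1_(A n) y * k1 x y) +
    (\int[leb]_y k2 x y - \int[leb]_y (\1_(A n) y * k2 x y))).
  by apply: is_cvgD; [exact: cvgP c1|apply: is_cvgB; [exact: is_cvg_cst|exact: cvgP c2]].
apply/funext => n.
rewrite /phase_mass (Rintegral_indic _ (A n)) (Rintegral_indic _ (B n)).
congr (_ + _).
  by apply: eq_Rintegral => y _; rewrite mulrC.
rewrite -RintegralB//.
  by apply: eq_Rintegral => y _; rewrite indic_partition mulrBr mulr1 mulrC.
apply: (integrable_dom measurableT _ mk2).
  apply: measurable_funM; first exact: measurable_indic.
  by have /integrableP[/measurable_EFinP] := mk2.
move=> y _; rewrite indicE; case: (_ \in _);
  rewrite ?mul1r ?mul0r ?normr0 ?ger0_norm//; exact: kernel_ge0.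
Qed.

Lemma measurable_phase_mass n : measurable_fun D (phase_mass n : Rn R N -> R).
Proof.
have H (k : V -> V -> R) (E : set (Rn R N)) : admissible_kernel k ->
    measurable E -> measurable_fun setT (fun x : Rn R N => \int[leb]_(y in E) k x y).
  move=> ak mE; under eq_fun do rewrite Rintegral_indic.
  apply: measurable_kernel_integral_ge0 => //.
  - exact: kernel_continuous ak.
  - exact: kernel_ge0 ak.
by apply: measurable_funTS; apply: measurable_funD; exact: H.
Qed.

Lemma sq_u n : sq_integrable leb D (u n).
Proof.
have [uL2 _] := uW n; split.
  by apply: measurable_funTS; have /= := set_mem (sub_Lfun_mfun uL2).
by apply: (integrableS measurableT) => //; exact: Lfun2_integrable_sqr.
Qed.

Lemma integrable_u n : leb.-integrable D (EFin \o u n).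
Proof. exact: sq_integrable_integrable (sq_u n). Qed.

Lemma sq_indic_u (E : set (Rn R N)) n : measurable E ->
  sq_integrable leb D (fun y => \1_E y * u n y).
Proof.
move=> mE; apply: (sq_integrable_dom mD _ (sq_u n)).
  apply: measurable_funM; last by case: (sq_u n).
  by apply: measurable_funTS; exact: measurable_indic.
by move=> x _; rewrite indicE; case: (_ \in _); rewrite ?mul1r ?mul0r ?normr0.
Qed.

Lemma sq_kernel (k : V -> V -> R) x : admissible_kernel k -> D x ->
  sq_integrable leb D (k x).
Proof.
move=> ak Dx; have [C kC] := kernel_bounded (kernel_continuous ak) D_bounded.
apply: (sq_integrable_dom mD _ (sq_integrable_cst mD D_fin C)).
  by apply: measurable_funTS; exact: measurable_kernel_section (kernel_continuous ak).
by move=> y Dy; rewrite (le_trans (kC _ _ Dx Dy))// ler_norm.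
Qed.

(** Weak convergence becomes pointwise here: the flux at [x] is the pairing of
    the two halves of [u n] with the bounded functions [k1 x] and [k2 x]. *)
Lemma phase_flux_cvg x : D x -> phase_flux n x @[n --> \oo] --> phase_flux_lim x.
Proof.
move=> Dx; apply: cvgD.
  by case: uA_weak => _ _; apply; apply: sq_integrable_L2 => //; exact: sq_kernel.
by case: uB_weak => _ _; apply; apply: sq_integrable_L2 => //; exact: sq_kernel.
Qed.

Lemma flux_restrict (k : V -> V -> R) (E : set (Rn R N)) n x :
  \int[leb]_(y in D) (\1_E y * u n y * k x y) =
  \int[leb]_y (k x y * ((fun y => \1_E y * u n y) \_ D) y).
Proof.
rewrite Rintegral_mkcond; apply: eq_Rintegral => y _.
by rewrite !patchE; case: ifPn => _; rewrite ?mulr0// mulrC.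
Qed.

Lemma measurable_phase_flux n : measurable_fun D (phase_flux n : Rn R N -> R).
Proof.
have H (k : V -> V -> R) (E : set (Rn R N)) : admissible_kernel k -> measurable E ->
    measurable_fun D (fun x : Rn R N => \int[leb]_(y in D) (\1_E y * u n y * k x y)).
  move=> ak mE; under eq_fun do rewrite flux_restrict.
  have su := sq_indic_u n mE.
  apply: measurable_kernel_integral.
  - exact: kernel_continuous ak.
  - exact: kernel_ge0 ak.
  - by apply/(measurable_restrictT _ mD); case: su.
  - move=> x Dx; have ik := sq_integrable_mul mD (sq_kernel ak Dx) su.
    move/(integrable_mkcond _ mD) : ik; apply: eq_integrable => // y _.
    by rewrite /= !patchE; case: ifPn => _ //; rewrite mulr0.
by apply: measurable_funD; exact: H.
Qed.

Lemma flux_le (k : V -> V -> R) : admissible_kernel k ->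
  exists2 C, 0 <= C & forall x (g : Rn R N -> R), D x -> leb.-integrable D (EFin \o g) ->
  `|\int[leb]_(y in D) (g y * k x y)| <= C * \int[leb]_(y in D) `|g y|.
Proof.
move=> ak; have [C kC] := kernel_bounded (kernel_continuous ak) D_bounded.
exists `|C| => // x g Dx ig.
have mg : measurable_fun D g by have /integrableP[/measurable_EFinP] := ig.
have iCg : leb.-integrable D (EFin \o (fun y => `|C| * `|g y|)).
  exact: (integrableZl mD `|C| (integrable_norm ig)).
have gk y : D y -> `|g y * k x y| <= `|C| * `|g y|.
  move=> Dy; rewrite normrM mulrC ler_wpM2r//.
  by rewrite (le_trans (kC _ _ Dx Dy))// ler_norm.
have igk : leb.-integrable D (EFin \o (fun y => g y * k x y)).
  apply: (integrable_dom mD _ iCg gk); apply: measurable_funM => //.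
  by apply: measurable_funTS; exact: measurable_kernel_section (kernel_continuous ak).
apply: (le_trans (le_normr_Rintegral mD igk)).
rewrite -RintegralZl//; last exact: integrable_norm.
apply: le_Rintegral => //; exact: integrable_norm igk.
Qed.

Lemma phase_flux_le : exists C, forall n x, D x ->
  `|phase_flux n x| <= C * \int[leb]_(y in D) `|u n y|.
Proof.
have [C1 C10 h1] := flux_le ak1; have [C2 C20 h2] := flux_le ak2.
exists (C1 + C2) => n x Dx; rewrite (le_trans (ler_normD _ _))// mulrDl.
have H (E : set (Rn R N)) : measurable E ->
    \int[leb]_(y in D) `|\1_E y * u n y| <= \int[leb]_(y in D) `|u n y|.
  move=> mE; apply: le_Rintegral => //.
  - apply: integrable_norm; exact: sq_integrable_integrable (sq_indic_u n mE).
  - exact: integrable_norm (integrable_u n).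
  - by move=> y _; rewrite indicE; case: (_ \in _); rewrite ?mul1r ?mul0r ?normr0.
have i (E : set (Rn R N)) : measurable E ->
    leb.-integrable D (EFin \o (fun y => \1_E y * u n y)).
  by move=> mE; exact: sq_integrable_integrable (sq_indic_u n mE).
apply: lerD; [apply: (le_trans (h1 x _ Dx (i _ (mA n))))|
  apply: (le_trans (h2 x _ Dx (i _ (mB n))))]; rewrite ler_wpM2l//; exact: H.
Qed.

Lemma phase_flux_lim_le : exists C, forall x, D x -> `|phase_flux_lim x| <= C.
Proof.
have [C1 C10 h1] := flux_le ak1; have [C2 C20 h2] := flux_le ak2.
exists (C1 * \int[leb]_(y in D) `|uA y| + C2 * \int[leb]_(y in D) `|uB y|).
move=> x Dx; rewrite (le_trans (ler_normD _ _))// lerD//.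
  apply: h1 => //; apply: sq_integrable_integrable => //.
  by apply: L2_sq_integrable => //; case: uA_weak.
apply: h2 => //; apply: sq_integrable_integrable => //.
by apply: L2_sq_integrable => //; case: uB_weak.
Qed.

(** Since [u n] vanishes almost everywhere outside [D], its contribution is an
    integral over [D] only, whereas the kernel's mass is taken on all of [E]. *)
Lemma nonlocal_intE (k : V -> V -> R) (E : set (Rn R N)) n x :
  admissible_kernel k -> measurable E -> D x ->
  nonlocal_int k E (u n) x = \int[leb]_(y in D) (\1_E y * u n y * k x y)
    - (\int[leb]_(y in E) k x y) * u n x.
Proof.
move=> ak mE Dx.
have mk : measurable_fun setT (k x : Rn R N -> R).
  exact: measurable_kernel_section (kernel_continuous ak).
have [uL2 u0] := uW n.
have mu_ : measurable_fun setT (u n).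
  by have /= := set_mem (sub_Lfun_mfun uL2).
have ikE : leb.-integrable E (EFin \o (k x : Rn R N -> R)).
  by apply: (integrableS measurableT) => //; exact: integrable_kernel.
have mur : measurable_fun setT (u n \_ D).
  by apply/(measurable_restrictT _ mD); exact: measurable_funTS.
have iku : leb.-integrable E (EFin \o (fun y => k x y * (u n \_ D) y)).
  apply: (integrableS measurableT) => //.
  have := sq_integrable_mul mD (sq_kernel ak Dx) (sq_u n).
  move=> /(integrable_mkcond _ mD); apply: eq_integrable => // y _.
  by rewrite /= !patchE; case: ifPn => _ //; rewrite mulr0.
rewrite flux_restrict -RintegralZr//.
transitivity (\int[leb]_(y in E) (k x y * (u n \_ D) y - k x y * u n x)).
  have mcst : measurable_fun setT (cst (u n x) : Rn R N -> R).
    exact: measurable_cst.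
  have m1 := measurable_funM mk (measurable_funB mu_ mcst).
  have m2 := measurable_funB (measurable_funM mk mur) (measurable_funM mk mcst).
  congr fine; apply: (ae_eq_integral _ _ mE).
  - exact/measurable_EFinP/(measurable_funTS m1).
  - exact/measurable_EFinP/(measurable_funTS m2).
  - apply: filterS u0 => y uy _; congr EFin; rewrite mulrBr patchE; case: ifPn => //.
    by move=> /negP yD; rewrite uy//; move=> /mem_set.
rewrite RintegralB//; last exact: (integrableZr mE (u n x) ikE).
congr (_ - _); rewrite Rintegral_indic; apply: eq_Rintegral => y _.
by rewrite !patchE; case: ifPn => _; rewrite ?mulr0 ?mul0r//; ring.
Qed.

End Phase.

(** * The corrector result *)

Lemma weakstar_restrict (R : realType) (N : nat) (D : set (Rn R N))
    (A : (set (Rn R N))^nat) (X : Rn R N -> R) (phi : Rn R N -> R) :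
  measurable D -> weakstar_Linfty_cvg (fun n => \1_(A n)) X ->
  (leb R N).-integrable D (EFin \o phi) ->
  (\int[leb R N]_(x in D) (\1_(A n) x * phi x)) @[n --> \oo] -->
  \int[leb R N]_(x in D) (X x * phi x).
Proof.
move=> mD [_ _ AX] iphi.
have pE (g : Rn R N -> R) :
    \int[leb R N]_(x in D) (g x * phi x) = \int[leb R N]_x (g x * (phi \_ D) x).
  rewrite Rintegral_mkcond; apply: eq_Rintegral => x _.
  by rewrite !patchE; case: ifPn; rewrite ?mulr0.
under eq_fun do rewrite pE.
rewrite pE; apply: AX; apply/Lfun1_integrable.
move/(integrable_mkcond _ mD) : iphi; apply: eq_integrable => // x _.
by rewrite /= !patchE; case: ifPn.
Qed.

Lemma weakstar_complement (R : realType) (N : nat) (D : set (Rn R N))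
    (A B : (set (Rn R N))^nat) (X : Rn R N -> R) (phi : Rn R N -> R) :
  measurable D -> (forall x, D x -> `|X x| <= 1) -> measurable_fun D X ->
  (forall n, A n `|` B n = setT) -> (forall n, A n `&` B n = set0) ->
  (forall n, measurable (A n)) ->
  (\int[leb R N]_(x in D) (\1_(A n) x * phi x)) @[n --> \oo] -->
  \int[leb R N]_(x in D) (X x * phi x) ->
  (leb R N).-integrable D (EFin \o phi) ->
  (\int[leb R N]_(x in D) (\1_(B n) x * phi x)) @[n --> \oo] -->
  \int[leb R N]_(x in D) ((1 - X x) * phi x).
Proof.
move=> mD X1 mX ABT AB0 mA AX iphi.
have mphi : measurable_fun D phi by have /integrableP[/measurable_EFinP] := iphi.
have E (g : Rn R N -> R) : measurable_fun D g -> (forall x, D x -> `|g x| <= 1) ->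
    \int[leb R N]_(x in D) ((1 - g x) * phi x) =
    \int[leb R N]_(x in D) phi x - \int[leb R N]_(x in D) (g x * phi x).
  move=> mg g1; rewrite -RintegralB//.
    by apply: eq_Rintegral => x _; rewrite mulrBl mul1r.
  apply: (integrable_dom mD _ (integrable_norm iphi)).
    exact: measurable_funM.
  by move=> x Dx; rewrite /= normrM ler_piMl// g1.
rewrite E//.
rewrite (_ : (fun n => _) = fun n => \int[leb R N]_(x in D) phi x -
    \int[leb R N]_(x in D) (\1_(A n) x * phi x)).
  by apply: cvgB; [exact: cvg_cst|exact: AX].
apply/funext => n; rewrite -E.
- by apply: eq_Rintegral => x _; rewrite (indic_partition ABT AB0).
- by apply: measurable_funTS; exact: measurable_indic.
- by move=> x _; rewrite indicE; case: (_ \in _); rewrite ?normr1 ?normr0.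
Qed.

Theorem theorem2p4 (R : realType) (N : nat) (Omega : set 'rV[R]_N.+1)
    (J G K : 'rV[R]_N.+1 -> 'rV[R]_N.+1 -> R)
    (A B : nat -> set (Rn R N)) (f : Rn R N -> R) (u : nat -> Rn R N -> R)
    (X uA uB : Rn R N -> R) (c0 c1 : R) :
  bounded_domain Omega ->
  admissible_kernel J -> admissible_kernel G -> admissible_kernel K ->
  (forall n, measurable (A n)) -> (forall n, measurable (B n)) ->
  (forall n, A n `|` B n = setT) -> (forall n, A n `&` B n = set0) ->
  L2 Omega f ->
  (forall n, dirichlet_solution Omega J G K (A n) (B n) f (u n)) ->
  weakstar_Linfty_cvg (fun n => \1_(A n)) X ->
  0 < c0 -> 0 < c1 -> (forall x, Omega x -> c0 <= X x <= 1 - c1) ->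
  weak_L2_cvg Omega (fun n => \1_(A n) \* u n) uA ->
  weak_L2_cvg Omega (fun n => \1_(B n) \* u n) uB ->
  L2norm Omega (u n \- corrector (A n) (B n) uA uB X) @[n --> \oo] --> 0%E.
Proof.
move=> dO aJ aG aK mA mB ABT AB0 fL2 uSol AX c00 c10 Xbd uAw uBw.
have bO : bounded_set Omega by case: dO.
have mO : measurable (Omega : set (Rn R N)).
  by apply: measurable_open; case: dO.
have O_fin : (leb R N Omega < +oo)%E by exact: leb_bounded_fin.
have uW n : W_Dir Omega (u n) by case: (uSol n).
pose aA := phase_mass J K A B; pose aB := phase_mass K G A B.
pose FA := phase_flux Omega J K A B u; pose FB := phase_flux Omega K G A B u.
pose FA' := phase_flux_lim Omega J K uA uB.
pose FB' := phase_flux_lim Omega K G uA uB.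
have [al1 al10 aA_ge] := kernels_mass_ge aJ aK bO.
have [al2 al20 aB_ge] := kernels_mass_ge aK aG bO.
pose al := Num.min al1 al2.
have al0 : 0 < al by rewrite lt_min al10.
have aAal n x : Omega x -> al <= aA n x.
  by move=> Ox; rewrite ge_min (aA_ge x _ _ Ox (mA n) (mB n)).
have aBal n x : Omega x -> al <= aB n x.
  by move=> Ox; rewrite ge_min (aB_ge x _ _ Ox (mA n) (mB n)) ?orbT.
have mFA n := measurable_phase_flux dO aJ aK mA mB uW n.
have mFB n := measurable_phase_flux dO aK aG mA mB uW n.
have maA n : measurable_fun (Omega : set (Rn R N)) (aA n) :=
  measurable_phase_mass aJ aK mA mB n.
have maB n : measurable_fun (Omega : set (Rn R N)) (aB n) :=
  measurable_phase_mass aK aG mA mB n.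
have FAc x (Ox : Omega x) := phase_flux_cvg dO aJ aK uAw uBw Ox.
have FBc x (Ox : Omega x) := phase_flux_cvg dO aK aG uAw uBw Ox.
have f2 := L2_sq_integrable mO fL2.
have iu n := integrable_u dO uW n.
(* on each phase the equation determines [u n] from the mass and the flux *)
have uE n : {ae leb R N, forall x, Omega x ->
    (A n x -> aA n x * u n x = FA n x - f x) /\
    (B n x -> aB n x * u n x = FB n x - f x)}.
  have [_] := uSol n; apply: filterS => x + Ox => /(_ Ox).
  rewrite !(nonlocal_intE dO uW n _ _ Ox)// => fE.
  split => [xA|xB].
    have xB : \1_(B n) x = 0 :> R.
      by rewrite (indic_partition ABT AB0) indicE mem_set// subrr.
    have xA1 : \1_(A n) x = 1 :> R by rewrite indicE mem_set.
    move: fE; rewrite xB xA1 => ->.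
    by rewrite /aA /FA /phase_mass /phase_flux; ring.
  have xA : \1_(A n) x = 0 :> R.
    rewrite indicE memNset// => xA; have : (A n `&` B n) x by [].
    by rewrite AB0.
  have xB1 : \1_(B n) x = 1 :> R by rewrite indicE mem_set.
  move: fE; rewrite xA xB1 => ->.
  by rewrite /aB /FB /phase_mass /phase_flux; ring.
have ae_imply (P Q : Rn R N -> Prop) : (forall x, P x -> Q x) ->
    {ae leb R N, forall x, P x} -> {ae leb R N, forall x, Q x}.
  exact: (@filterS _ _ (ae_filter_ringOfSetsType (leb R N))).
have [C1 FA_le] := phase_flux_le dO aJ aK mA mB uW.
have [C2 FB_le] := phase_flux_le dO aK aG mA mB uW.
(* [`|u n|] is controlled by the two fluxes, which are linear in its L1 norm *)
have [M uM] : exists M, forall n, \int[leb R N]_(x in Omega) `|u n x| <= M.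
  have [C3 FA'_le] := phase_flux_lim_le dO aJ aK uAw uBw.
  have [C4 FB'_le] := phase_flux_lim_le dO aK aG uAw uBw.
  have if1 := sq_integrable_integrable mO O_fin f2.
  have mF n : measurable_fun (Omega : set (Rn R N))
      (fun x => `|FA n x| + `|FB n x|).
    exact: (measurable_funD (measurable_fun_normr (mFA n))
      (measurable_fun_normr (mFB n))).
  apply: (@implicit_L1_bound _ _ _ _ _ mO O_fin u
    (fun n x => `|FA n x| + `|FB n x|) f (fun x => `|FA' x| + `|FB' x|) al
    (C1 + C2) (C3 + C4) iu if1 mF _ _ _ al0).
  - by move=> x Ox; apply: cvgD; apply: cvg_norm; [exact: FAc|exact: FBc].
  - move=> n x Ox; rewrite ger0_norm ?addr_ge0// mulrDl.
    exact: (lerD (FA_le n x Ox) (FB_le n x Ox)).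
  - by move=> x Ox; rewrite ger0_norm ?addr_ge0// (lerD (FA'_le x Ox) (FB'_le x Ox)).
  move=> n; apply: ae_imply (uE n) => x ux Ox.
  rewrite (ger0_norm (addr_ge0 (normr_ge0 (FA n x)) (normr_ge0 (FB n x)))).
  have [uxA uxB] := ux Ox.
  have H (a F : R) : al <= a -> a * u n x = F - f x ->
      al * `|u n x| <= `|F| + `|f x|.
    move=> ala aE; apply: (le_trans _ (ler_normB _ _)); rewrite -aE normrM.
    by rewrite ler_wpM2r// (le_trans ala)// ler_norm.
  have : (A n `|` B n) x by rewrite ABT.
  case=> [/uxA|/uxB] eq_u.
    by apply: (le_trans (H _ _ (aAal _ _ Ox) eq_u)); rewrite lerD2r lerDl.
  by apply: (le_trans (H _ _ (aBal _ _ Ox) eq_u)); rewrite lerD2r lerDr.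
have Fbd (F : (Rn R N -> R)^nat) C : (forall n x, Omega x ->
    `|F n x| <= C * \int[leb R N]_(x in Omega) `|u n x|) ->
    forall n x, Omega x -> `|F n x| <= `|C| * M.
  move=> h n x Ox; rewrite (le_trans (h _ _ Ox))//.
  rewrite (@le_trans _ _ (`|C| * \int[leb R N]_(x in Omega) `|u n x|))//.
    by rewrite ler_wpM2r ?ler_norm// Rintegral_ge0.
  by rewrite ler_wpM2l.
have mX : measurable_fun (Omega : set (Rn R N)) X.
  case: AX => _ XL _; apply: measurable_funTS.
  by have /= := set_mem (sub_Lfun_mfun XL).
have sqA : sq_integrable (leb R N) Omega uA.
  by apply: L2_sq_integrable => //; case: uAw.
have sqB : sq_integrable (leb R N) Omega uB.
  by apply: L2_sq_integrable => //; case: uBw.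
have mu_ n : measurable_fun (Omega : set (Rn R N)) (u n).
  by have /integrableP[/measurable_EFinP] := iu n.
have X_norm x : Omega x -> `|X x| <= 1.
  by move=> Ox; have /andP[h1 h2] := Xbd _ Ox; rewrite ger0_norm; lra.
have BX phi : (leb R N).-integrable Omega (EFin \o phi) ->
    (\int[leb R N]_(x in Omega) (\1_(B n) x * phi x)) @[n --> \oo] -->
    \int[leb R N]_(x in Omega) ((1 - X x) * phi x).
  move=> iphi; apply: (@weakstar_complement _ _ _ A B X phi mO X_norm mX ABT AB0 mA) => //.
  exact: weakstar_restrict.
have cvA := @one_phase_strong_cvg _ _ _ (leb R N) _ mO O_fin A u aA FA f X uA
  (fun x => limn (aA^~ x)) FA' c0 al _ mA mu_ maA mFA f2 sqA mX c00 al0 _ aAal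
  (Fbd _ _ FA_le).
have {}cvA : (\int[leb R N]_(x in Omega)
    ((\1_(A n) x * (u n x - uA x / X x)) ^+ 2)%:E)%E @[n --> \oo] --> 0%E.
  apply: cvA.
  - by move=> x Ox; have /andP[h1 h2] := Xbd _ Ox; rewrite h1/=; lra.
  - by move=> x Ox; exact: (phase_mass_cvg aJ aK mA ABT AB0 AX).
  - exact: FAc.
  - by move=> n; apply: ae_imply (uE n) => x h Ox; case: (h Ox).
  - by move=> phi; exact: weakstar_restrict.
  - by move=> phi phi2; case: uAw => _ _; apply; exact: sq_integrable_L2.
(* the phase [B] is the phase [A] of the problem with the roles exchanged *)
have mX1 : measurable_fun (Omega : set (Rn R N)) (fun x => 1 - X x).
  have m1 : measurable_fun (Omega : set (Rn R N)) (cst 1 : Rn R N -> R).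
    exact: measurable_cst.
  exact: (measurable_funB m1 mX).
have cvB := @one_phase_strong_cvg _ _ _ (leb R N) _ mO O_fin B u aB FB f
  (fun x => 1 - X x) uB
  (fun x => limn (aB^~ x)) FB' c1 al _ mB mu_ maB mFB f2 sqB mX1 c10 al0 _ aBal
  (Fbd _ _ FB_le).
have {}cvB : (\int[leb R N]_(x in Omega)
    ((\1_(B n) x * (u n x - uB x / (1 - X x))) ^+ 2)%:E)%E @[n --> \oo] --> 0%E.
  apply: cvB.
  - by move=> x Ox; have /andP[h1 h2] := Xbd _ Ox; apply/andP; split; lra.
  - by move=> x Ox; exact: (phase_mass_cvg aK aG mA ABT AB0 AX).
  - exact: FBc.
  - by move=> n; apply: ae_imply (uE n) => x h Ox; case: (h Ox).
  - exact: BX.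
  - by move=> phi phi2; case: uBw => _ _; apply; exact: sq_integrable_L2.
have X_gt0 x : Omega x -> 0 < X x.
  by move=> /Xbd /andP[h1 _]; exact: lt_le_trans h1.
have X1_gt0 x : Omega x -> 0 < 1 - X x by move=> /Xbd /andP[_ h2]; lra.
have mEA n := measurable_phase_error mO (mA n) (mu_ n) sqA.1 mX X_gt0.
have mEB n := measurable_phase_error mO (mB n) (mu_ n) sqB.1 mX1 X1_gt0.
have errorE n : (\int[leb R N]_(x in Omega)
      ((u n \- corrector (A n) (B n) uA uB X) x ^+ 2)%:E =
    \int[leb R N]_(x in Omega) ((\1_(A n) x * (u n x - uA x / X x)) ^+ 2)%:E +
    \int[leb R N]_(x in Omega)
      ((\1_(B n) x * (u n x - uB x / (1 - X x))) ^+ 2)%:E)%E.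
  have sq0 (g : Rn R N -> R) x : Omega x -> (0 <= (g x ^+ 2)%:E)%E.
    by rewrite lee_fin sqr_ge0.
  rewrite -(ge0_integralD (leb R N) mO (sq0 _) (mEA n) (sq0 _) (mEB n)).
  apply: eq_integral => x _; rewrite -EFinD; congr EFin.
  (* at each point only the term of one phase survives *)
  rewrite /corrector /= (indic_partition ABT AB0) indicE.
  by case: (_ \in _); rewrite /=; ring.
apply: L2norm_cvg0; under eq_fun do rewrite errorE.
by rewrite -[0%E]adde0; exact: cvgeD.
Qed.
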